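(* Let $H\in(0,1)$ and let $(L_t)_{t\ge0}$ be a Lévy process without Gaussian component, not identically zero, with $\mathbb E L_1=0$ and $\mathbb E L_1^2<\infty$. Then the fLpMG $Y_t=\int_0^t z_H(t,s)\,dL_s$ is not self-similar: there is no $\alpha\in\mathbb R$ such that $(Y_{ct})_{t\ge0}\overset{d}{=}(c^\alpha Y_t)_{t\ge0}$ for all $c>0$.
   Context: Molchan–Golosov kernel: $z_H(t,s)=c_H(t-s)^{H-1/2}F\big(\tfrac12-H,H-\tfrac12,H+\tfrac12,\tfrac{s-t}{s}\big)$ for $0<s<t$, $z_H(t,s)=0$ otherwise, where $F(a,b,c,x)=\sum_{j\ge0}\frac{(a)_j(b)_j}{(c)_j}\frac{x^j}{j!}$ and $c_H=\frac{1}{\Gamma(H+1/2)}\big(\frac{2H\Gamma(H+1/2)\Gamma(3/2-H)}{\Gamma(2-2H)}\big)^{1/2}$. The integral is the $L^2(\mathbb P)$-limit of integrals of step functions.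
   Formalization: The series for F diverges at (s-t)/s < -1 (i.e. s < t/2), so F is taken as the Gauss hypergeometric function: the series for x > -1 and its analytic continuation by Pfaff's transformation for x ≤ -1. *)

(* Defs.v *)
From HB Require Import structures.
From mathcomp Require Import all_boot all_order all_algebra.
From mathcomp Require Import all_classical all_reals all_analysis.
Set Implicit Arguments. Unset Strict Implicit. Unset Printing Implicit Defensive.
Import Order.TTheory GRing.Theory Num.Theory.
Import numFieldNormedType.Exports.
Local Open Scope classical_set_scope.
Local Open Scope ring_scope.

Section Defs.
Variable R : realType.

Definition pochhammer (a : R) (j : nat) : R := \prod_(i < j) (a + i%:R).

Definition hyp_term (a b c x : R) (j : nat) : R :=
  pochhammer a j * pochhammer b j / pochhammer c j * x ^+ j / (j`!)%:R.
Definition hyp_series (a b c x : R) : R := limn (series (hyp_term a b c x)).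

(* The hypergeometric function F(a,b,c,x) for x < 1: the series for |x| < 1,
   and its analytic continuation via Pfaff's transformation
   F(a,b,c,x) = (1-x)^(-a) F(a,c-b,c,x/(x-1)) for x <= -1. *)
Definition hypgeom (a b c x : R) : R :=
  if -1 < x then hyp_series a b c x
  else (1 - x) `^ (- a) * hyp_series a (c - b) c (x / (x - 1)).

Definition Gamma (x : R) : R :=
  Rintegral (@lebesgue_measure R) [set t : R | 0 < t] (fun t => t `^ (x - 1) * expR (- t)).

Definition cH (H : R) : R :=
  (Gamma (H + 2^-1))^-1 *
  Num.sqrt (2 * H * Gamma (H + 2^-1) * Gamma (3/2 - H) / Gamma (2 - 2 * H)).

Definition zH (H t s : R) : R :=
  if (0 < s) && (s < t) then
    cH H * (t - s) `^ (H - 2^-1) * hypgeom (2^-1 - H) (H - 2^-1) (H + 2^-1) ((s - t) / s)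
  else 0.

Definition stepfun (n : nat) (a l r : 'I_n -> R) (x : R) : R :=
  \sum_(i < n) (if (l i < x) && (x <= r i) then a i else 0).

Variables (d : measure_display) (Omega : measurableType d) (P : probability Omega R).

Definition stepint (L : R -> Omega -> R) (n : nat) (a l r : 'I_n -> R) (w : Omega) : R :=
  \sum_(i < n) a i * (L (r i) w - L (l i) w).

Definition is_L2_stoch_integral (L : R -> Omega -> R) (f : R -> R) (Y : Omega -> R) : Prop :=
  forall (N : nat -> nat) (a l r : forall k, 'I_(N k) -> R),
    (forall k i, 0 <= l k i /\ l k i <= r k i) ->
    (fun k => (\int[@lebesgue_measure R]_(x in [set x : R | (0 <= x)%R])
                 ((stepfun (a k) (l k) (r k) x - f x) ^+ 2)%:E)%E) @ \oo --> 0%E ->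
    (fun k => (\int[P]_w ((stepint L (a k) (l k) (r k) w - Y w) ^+ 2)%:E)%E) @ \oo --> 0%E.

Definition mutually_independent (n : nat) (X : 'I_n -> Omega -> R) : Prop :=
  forall B : 'I_n -> set R, (forall i, measurable (B i)) ->
    P [set w | forall i, B i (X i w)] = (\prod_(i < n) P [set w | B i (X i w)])%E.

Definition cadlag_on_nonneg (f : R -> R) : Prop :=
  forall t, 0 <= t ->
    f x @[x --> t^'+] --> f t /\ (0 < t -> cvg (f x @[x --> t^'-])).

Definition levy_process (L : R -> {RV P >-> R}) : Prop :=
  [/\ P [set w | L 0 w != 0] = 0%E,
      (forall (n : nat) (t : nat -> R), 0 <= t 0%N ->
         (forall k, (k < n)%N -> t k <= t k.+1) ->
         mutually_independent (fun i : 'I_n => fun w => L (t i.+1) w - L (t i) w)),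
      (forall s t (B : set R), 0 <= s -> 0 <= t -> measurable B ->
         P [set w | B (L (t + s) w - L s w)] = P [set w | B (L t w)]),
      (forall t (e eta : R), 0 <= t -> 0 < e -> 0 < eta ->
         exists2 delta : R, 0 < delta & forall s, 0 <= s -> `|s - t| < delta ->
           (P [set w | (e < `|L s w - L t w|)%R] < eta%:E)%E) &
      {ae P, forall w, cadlag_on_nonneg (fun t => L t w)}].

(* Levy-Khintchine representation of L_1 with Gaussian coefficient sigma2,
   drift gamma and Levy measure nu:
   E exp(iuL_1) = exp(i u gamma - sigma2 u^2/2
                     + int (e^{iux} - 1 - iux 1_{|x|<=1}) nu(dx)),
   written through real and imaginary parts. *)
Definition levy_khintchine (X : Omega -> R) (gamma sigma2 : R)
    (nu : {measure set R -> \bar R}) : Prop :=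
  [/\ 0 <= sigma2, nu [set 0] = 0%E,
      (\int[nu]_x (Num.min 1 (x ^+ 2))%:E < +oo)%E &
      forall u : R,
        let A := - (sigma2 * u ^+ 2 / 2) + Rintegral nu setT (fun x => cos (u * x) - 1) in
        let B := u * gamma + Rintegral nu setT
                   (fun x => sin (u * x) - (if `|x| <= 1 then u * x else 0)) in
        (\int[P]_w (cos (u * X w))%:E = (expR A * cos B)%:E)%E /\
        (\int[P]_w (sin (u * X w))%:E = (expR A * sin B)%:E)%E].

Definition no_gaussian_component (L : R -> {RV P >-> R}) : Prop :=
  exists (gamma : R) (nu : {measure set R -> \bar R}), levy_khintchine (L 1) gamma 0 nu.

Definition self_similar (Y : R -> {RV P >-> R}) (alpha : R) : Prop :=
  forall c : R, 0 < c ->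
  forall (n : nat) (t : 'I_n -> R) (B : 'I_n -> set R),
    (forall i, 0 <= t i) -> (forall i, measurable (B i)) ->
    P [set w | forall i, B i (Y (c * t i) w)] =
    P [set w | forall i, B i (c `^ alpha * Y (t i) w)].

End Defs.

(* Main.v *)
(** Let [M_X u = |E exp(iuX)|^2] and let [- psi] be the real part of the exponent
    of [L_1], so that [M_(L_1) u = exp(- 2 psi u)].  Approximating the kernel by step
    functions on finer and finer grids gives
    [M_(Y_t) u = lim exp(- 2 h \sum_i psi (u z_H(t, s_i)))].
    The kernel satisfies [z_H(t, s) = t^(H - 1/2) z_H(1, s/t)] and
    [z_H(1, s)^2 <= D min(s, 1 - s)^(- |1 - 2H|)], hence a bound
    [psi x <= kappa x^2 + lambda] implies
    [M_(Y_t) u >= exp(- 2 (kappa C u^2 t^(2H) + lambda t))].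
    If [Y] were self-similar with index [alpha], then [M_(Y_1) v = M_(Y_c) (v c^(- alpha))]
    would be at least [exp(- 2 (kappa C v^2 c^(2H - 2 alpha) + lambda c))] for all [c].
    For [alpha > H] use [psi x <= V x^2] (finite second moment) and let [c] tend to
    infinity; for [alpha <= H] use that, without Gaussian component, [kappa] can be
    taken arbitrarily small, and let [c] tend to 0.  Either way [M_(Y_1) v = 1] for
    all [v].  But [psi x >= c0 x^2] near 0, since [L_1] is not almost surely zero,
    and [z_H(1, .)] is bounded below on an interval, so [M_(Y_1) v < 1] for some [v]. *)

Require Import Defs.
From HB Require Import structures.
From mathcomp Require Import all_boot all_order all_algebra.
From mathcomp Require Import all_classical all_reals all_analysis.
From mathcomp Require Import measurable_realfun.
From mathcomp Require Import ring lra zify.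
Set Implicit Arguments.
Unset Strict Implicit.
Unset Printing Implicit Defensive.
Import Order.TTheory GRing.Theory Num.Theory.
Import numFieldNormedType.Exports.
Local Open Scope classical_set_scope.
Local Open Scope ring_scope.

(** * Powers and power series *)

(** The squared modulus keeps what the argument needs and discards the rest: drift and compensator
    only rotate the characteristic function, sums of independent variables become products of
    nonnegative reals, and the N-th root that leads from L_1 to L_(1/N) is unique, without complex
    logarithms.

    The kernel obstructs naive Riemann sums: it may be singular at both ends of (0, t), and the two
    formulas for [hypgeom] meet at s = t/2, where continuity is not established. Grids with an even
    number of cells and tags turned towards t/2 keep the tags off 0 and t, and let one integrable
    majorant serve both for the sums and for dominated convergence.

    Only rational times t = a/b are treated. The mesh can then be 1/N for an integer N, so that
    L_(1/N) is the only increment whose law is needed, and the scales c = n and c = 1/n suffice for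
    the two limits.

    That L is not identically zero says nothing directly about L_1; that L_1 = 0 almost surely
    forces L_t = 0 almost surely for every t is proved separately. *)

Lemma powR_bernoulli (R : realType) (y b : R) :
  0 < y -> 0 <= b <= 1 -> y `^ b <= 1 + b * (y - 1).
Proof.
move=> y0 /andP[b0 b1].
have [x ->] : exists x, y = expR x by exists (ln y); rewrite lnK.
rewrite /powR gt_eqF ?expR_gt0// expRK.
have h1 : expR (b * x) * (1 + (1 - b) * x) <= expR x.
  rewrite -[in leRHS](addrK (b * x) x) addrAC addrC expRD.
  rewrite ler_pM2l ?expR_gt0//.
  by apply: le_trans (expR_ge1Dx _); rewrite mulrBl mul1r.
have h2 : expR (b * x) * (1 - b * x) <= 1.
  rewrite -[leRHS](expRxMexpNx_1 (b * x)) ler_pM2l ?expR_gt0//.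
  by apply: le_trans (expR_ge1Dx _).
(* With weights b for [h1] and 1 - b for [h2], the terms linear in x cancel. *)
have := ler_wpM2l b0 h1.
have : (1 - b) * (expR (b * x) * (1 - b * x)) <= (1 - b) * 1.
  by apply: ler_wpM2l => //; rewrite subr_ge0.
set e := expR (b * x); set f := expR x; nra.
Qed.

Lemma powRN_bernoulli (R : realType) (x q : R) :
  0 <= x -> 0 <= q -> 1 - q * x <= (1 + x) `^ (- q).
Proof.
move=> x0 q0; rewrite /powR gt_eqF ?ltr_pwDl//.
apply: le_trans (expR_ge1Dx _).
rewrite mulNr lerD2l lerN2 ler_wpM2l//.
have h : 0 < 1 + x by rewrite ltr_pwDl.
by rewrite -ler_expR lnK// expR_ge1Dx.
Qed.

(** Discrete form of the comparison with the integral of x^(-p). The induction step is the tangent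
    bound (n/(n+1))^(1-p) <= 1 - (1-p)/(n+1). *)
Lemma sum_powRN_le (R : realType) (p : R) (n : nat) : 0 <= p < 1 ->
  \sum_(i < n) (i.+1%:R : R) `^ (- p) <= n%:R `^ (1 - p) / (1 - p).
Proof.
move=> /andP[p0 p1].
have q0 : 0 < 1 - p by rewrite subr_gt0.
elim: n => [|n ih]; first by rewrite big_ord0 divr_ge0 ?powR_ge0 ?ltW.
rewrite big_ord_recr/=; apply: le_trans (lerD ih (lexx _)) _.
rewrite ler_pdivlMr// mulrDl divfK ?gt_eqF//.
have n0 : 0 < n.+1%:R :> R by rewrite ltr0n.
have -> : n%:R `^ (1 - p) = n.+1%:R `^ (1 - p) * (n%:R / n.+1%:R) `^ (1 - p) :> R.
  by rewrite -powRM ?divr_ge0// mulrC divfK ?gt_eqF.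
have -> : n.+1%:R `^ (- p) = n.+1%:R `^ (1 - p) / n.+1%:R :> R.
  rewrite -[X in _ / X]powRr1 ?ltW// -powRN -powRD ?(gt_eqF n0) ?implybT//.
  by congr (_ `^ _); ring.
have y0 : 0 <= n%:R / n.+1%:R :> R by rewrite divr_ge0.
have yE : n%:R / n.+1%:R = 1 - n.+1%:R^-1 :> R.
  by rewrite -[n.+1%:R]natr1; field; rewrite natr1 gt_eqF.
have hB : (n%:R / n.+1%:R) `^ (1 - p) <= 1 - (1 - p) / n.+1%:R :> R.
  (* The case n = 0 is apart, because [powR_bernoulli] wants a positive base. *)
  have [y1|y1] := eqVneq (n%:R / n.+1%:R : R) 0.
    rewrite y1 powR0 ?(gt_eqF q0)// subr_ge0 ler_pdivrMr// mul1r.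
    by apply: (@le_trans _ _ 1); rewrite ?ler1n// lerBlDr lerDl.
  apply: le_trans (powR_bernoulli _ _) _; first by rewrite lt_neqAle eq_sym y1.
    by rewrite ltW//= lerBlDr lerDl.
  by rewrite yE le_eqVlt; apply/orP; left; apply/eqP; ring.
have := ler_wpM2l (powR_ge0 (n.+1%:R : R) (1 - p)) hB.
set A := n.+1%:R `^ _; set B := _ `^ (1 - p); move: n.+1%:R^-1 => z.
lra.
Qed.

Lemma pochhammerS (R : realType) (a : R) (j : nat) :
  pochhammer a j.+1 = pochhammer a j * (a + j%:R).
Proof. by rewrite /pochhammer big_ord_recr. Qed.

Lemma pochhammer0 (R : realType) (a : R) : pochhammer a 0 = 1.
Proof. by rewrite /pochhammer big_ord0. Qed.

Lemma pochhammer_gt0 (R : realType) (a : R) (j : nat) :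
  0 < a -> 0 < pochhammer a j.
Proof. by move=> a0; apply: prodr_gt0 => i _; rewrite ltr_wpDr. Qed.

Lemma pochhammer1 (R : realType) (j : nat) : pochhammer 1 j = (j`!)%:R :> R.
Proof.
by elim: j => [|j ih]; rewrite ?pochhammer0// pochhammerS ih factS mulnC natrM nat1r.
Qed.

Lemma pochhammer_shift (R : realType) (a : R) (j : nat) :
  a * pochhammer (a + 1) j = pochhammer a j.+1.
Proof.
by rewrite /pochhammer big_ord_recl addr0; congr (_ * _); apply: eq_bigr => i _;
  rewrite /= /bump/= add1n -nat1r addrA.
Qed.

Lemma sum_pochhammer_fact (R : realType) (b : R) (n : nat) :
  \sum_(j < n.+1) pochhammer b j / (j`!)%:R = pochhammer (b + 1) n / (n`!)%:R.
Proof.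
elim: n => [|n ih]; first by rewrite big_ord1 !pochhammer0.
rewrite big_ord_recr/= ih -pochhammer_shift pochhammerS factS natrM -[n.+1%:R]natr1.
have n0 : (n`!)%:R != 0 :> R by rewrite pnatr_eq0 -lt0n fact_gt0.
have n1 : n%:R + 1 != 0 :> R by rewrite natr1 pnatr_eq0.
by field; rewrite n0 n1.
Qed.

Lemma pochhammer_le0 (R : realType) (b : R) (j : nat) :
  -1 < b <= 0 -> pochhammer b j.+1 <= 0.
Proof.
move=> /andP[b1 b0]; rewrite -pochhammer_shift.
by rewrite mulr_le0_ge0// ltW// pochhammer_gt0//; lra.
Qed.

(** In [sum_pochhammer_fact] every term but the first is nonpositive, while the closed form is
    nonnegative because b + 1 > 0. The absolute values of the other terms thus add up to at most the
    first term, 1. *)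
Lemma sum_norm_pochhammer (R : realType) (b : R) (n : nat) : -1 < b <= 0 ->
  \sum_(j < n) `|pochhammer b j.+1| / (j.+1`!)%:R <= 1.
Proof.
move=> hb; have /andP[b1 b0] := hb.
under eq_bigr do rewrite ler0_norm ?pochhammer_le0// mulNr.
rewrite sumrN.
have := sum_pochhammer_fact b n; rewrite big_ord_recl/= pochhammer0 fact0 divr1.
have : 0 <= pochhammer (b + 1) n / (n`!)%:R.
  by rewrite divr_ge0// ltW// pochhammer_gt0//; lra.
lra.
Qed.

Lemma pseries_bounded_cvg (R : realType) (c : R^nat) (s K x : R) :
  (forall i, `|c i| * s ^+ i <= K) -> `|x| < s -> cvgn (pseries c x).
Proof.
move=> cK xs; have s0 : 0 < s by apply: le_lt_trans xs.
have K0 : 0 <= K by apply: le_trans (cK 0%N); rewrite mulr_ge0.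
apply: normed_cvg.
apply: (@series_le_cvg _ _ (geometric K (`|x| / s))) => [n|n|n|].
- exact: normr_ge0.
- by rewrite /geometric/= mulr_ge0// exprn_ge0// divr_ge0// ltW.
- rewrite /geometric/= normrM normrX exprMn.
  rewrite -[in leLHS](mulr1 `|c n|) -(@mulfV _ (s ^+ n)) ?expf_neq0 ?gt_eqF//.
  rewrite exprVn mulrA -mulrA [leRHS](_ : _ = K * (`|x| ^+ n / s ^+ n)); last by ring.
  rewrite [leLHS](_ : _ = `|c n| * s ^+ n * (`|x| ^+ n / s ^+ n)); last by ring.
  by rewrite ler_wpM2r// divr_ge0 ?exprn_ge0// ltW.
- apply: is_cvg_geometric_series.
  by rewrite normrM normr_id normfV (gtr0_norm s0) ltr_pdivrMr// mul1r.
Qed.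

Lemma natr_exp_le (R : realType) (t : R) (i : nat) : 0 <= t < 1 ->
  i.+1%:R * t ^+ i <= (1 - t)^-1.
Proof.
move=> /andP[t0 t1].
have u0 : 0 < 1 - t by rewrite subr_gt0.
rewrite -[leRHS]mul1r ler_pdivlMr//.
apply: (@le_trans _ _ ((\sum_(k < i.+1) t ^+ k) * (1 - t))); last first.
  rewrite mulrC -opprB mulNr -subrX1 opprB lerBlDr lerDl exprn_ge0//.
rewrite ler_wpM2r ?(ltW u0)// mulrC mulr_natr -[X in _ *+ X](card_ord i.+1) -sumr_const.
by apply: ler_sum => k _; rewrite ler_wiXn2l ?(ltW t1)// -ltnS.
Qed.

(** A formal derivative keeps a bound of the same type at the price of a smaller radius: (i+1) t^i
    stays bounded for t = r/s < 1. *)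
Lemma pseries_diffs_bounded (R : realType) (c : R^nat) (s r K : R) :
  (forall i, `|c i| * s ^+ i <= K) -> 0 <= r < s ->
  forall i, `|pseries_diffs c i| * r ^+ i <= K / (s - r).
Proof.
move=> cK /andP[r0 rs] i; have s0 : 0 < s by apply: le_lt_trans rs.
have K0 : 0 <= K by apply: le_trans (cK 0%N); rewrite mulr_ge0.
rewrite /pseries_diffs normrM normr_nat.
have -> : i.+1%:R * `|c i.+1| * r ^+ i =
    (`|c i.+1| * s ^+ i.+1) * ((i.+1%:R * (r / s) ^+ i) / s).
  rewrite exprMn exprVn exprS; field.
  by rewrite expf_neq0 gt_eqF.
have -> : K / (s - r) = K * ((1 - r / s)^-1 / s).
  by field; rewrite !gt_eqF// subr_gt0.
have t0 : 0 <= r / s by rewrite divr_ge0// ltW.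
have t1 : r / s < 1 by rewrite ltr_pdivrMr// mul1r.
apply: ler_pM => //.
- by rewrite mulr_ge0// exprn_ge0// ltW.
- by rewrite divr_ge0 ?(ltW s0)// mulr_ge0// exprn_ge0.
- by rewrite ler_pM2r ?invr_gt0// natr_exp_le// t0.
Qed.

(** Continuity comes from differentiability; [pseries_snd_diffs] asks for convergence of the series
    and of its first two formal derivatives at a point beyond |x|. *)
Lemma pseries_continuous (R : realType) (c : R^nat) (K x : R) :
  (forall i, `|c i| <= K) -> `|x| < 1 ->
  {for x, continuous (fun y => limn (pseries c y))}.
Proof.
move=> cK x1.
have x0 := normr_ge0 x.
(* Radii decreasing from [s 0] = 1 towards |x|: each of the two derivatives uses up one, and [s 3]
   is the point of evaluation. *)
pose s i : R := `|x| + (1 - `|x|) / i.+1%:R.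
have sS i : s i.+1 < s i.
  rewrite ltrD2l ltr_pM2l ?subr_gt0// ltf_pV2 ?posrE ?ltr0n// ltr_nat//.
have s0 i : 0 <= s i by rewrite addr_ge0// divr_ge0// subr_ge0 ltW.
have h0 i : `|c i| * s 0%N ^+ i <= K by rewrite /s divr1 addrC subrK expr1n mulr1.
have h1 := pseries_diffs_bounded h0 (introT andP (conj (s0 1%N) (sS 0%N))).
have h2 := pseries_diffs_bounded h1 (introT andP (conj (s0 2%N) (sS 1%N))).
have ns i : `|s i| = s i by rewrite ger0_norm.
have xs : `|x| < `|s 3%N| by rewrite ns /s ltrDl divr_gt0// subr_gt0.
have hd := @pseries_snd_diffs _ c (s 3%N) x
  (pseries_bounded_cvg h0 _) (pseries_bounded_cvg h1 _) (pseries_bounded_cvg h2 _) xs.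
apply/differentiable_continuous/derivable1_diffP.
apply: ex_derive; apply: hd; rewrite ns.
- exact: (lt_trans (sS 2%N) (lt_trans (sS 1%N) (sS 0%N))).
- exact: (lt_trans (sS 2%N) (sS 1%N)).
- exact: (sS 2%N).
Qed.

Lemma pseries_sum_bound (R : realType) (c : R^nat) (K x : R) :
  (forall n, \sum_(j < n) `|c j.+1| <= K) -> `|x| <= 1 ->
  cvgn (pseries c x) /\ `|limn (pseries c x) - c 0%N| <= K * `|x|.
Proof.
move=> cK x1.
have cv : cvgn (pseries c x).
  apply: normed_cvg; apply: nondecreasing_is_cvgn.
    by apply: nondecreasing_series => n _ _; exact: normr_ge0.
  exists (`|c 0%N| + K) => _ [n _ <-].
  rewrite /normed_series_of /series/= big_mkord.
  case: n => [|n]; first by rewrite big_ord0 addr_ge0//; apply: le_trans (cK 0%N); rewrite big_ord0.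
  rewrite big_ord_recl expr0 mulr1 lerD2l; apply: le_trans (cK n).
  apply: ler_sum => i _; rewrite normrM -[leRHS]mulr1 ler_wpM2l//.
  by rewrite normrX exprn_ile1.
split=> //.
have h n : `|pseries c x n.+1 - c 0%N| <= K * `|x|.
  rewrite /pseries /series/= big_mkord big_ord_recl expr0 mulr1 addrC addKr.
  apply: le_trans (ler_norm_sum _ _ _) _.
  apply: le_trans (ler_wpM2r (normr_ge0 x) (cK n)); rewrite mulr_suml.
  apply: ler_sum => i _; rewrite normrM ler_wpM2l//.
  rewrite normrX exprS -[leRHS]mulr1 ler_wpM2l//.
  by rewrite exprn_ile1.
have cv2 : (fun n => `|pseries c x n - c 0%N|) @ \oo --> `|limn (pseries c x) - c 0%N|.
  by apply: cvg_norm; apply: cvgB => //; exact: cvg_cst.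
rewrite -(cvg_lim _ cv2)//; apply: limr_le; first by apply/cvg_ex; eexists; exact: cv2.
by exists 1%N => // -[|n]//= _; exact: h.
Qed.

Lemma one_powR (R : realType) (q : R) : 1 `^ q = 1.
Proof. by rewrite powR1. Qed.

Lemma le_powRN (R : realType) (x y q : R) :
  0 < x -> x <= y -> 0 <= q -> y `^ (- q) <= x `^ (- q).
Proof.
move=> x0 xy q0; have y0 : 0 < y by apply: lt_le_trans xy.
rewrite !powRN lef_pV2 ?posrE ?powR_gt0//.
by apply: ge0_ler_powR; rewrite // nnegrE ltW.
Qed.

Lemma powR_continuous (R : realType) (q x : R) : 0 < x ->
  {for x, continuous (fun y => y `^ q)}.
Proof.
move=> x0; apply/differentiable_continuous/derivable1_diffP.
by apply: derivable_powR; rewrite in_itv/= x0.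
Qed.

(** * The hypergeometric series and the Molchan-Golosov kernel *)

(** With a = 1/2 - H the kernel has the parameters (a, -a, 1 - a). Pfaff's transformation turns them
    into (a, 1, 1 - a), where (1)_j cancels j!. *)
Definition hyp_coef (R : realType) (a b c : R) (j : nat) : R :=
  pochhammer a j * pochhammer b j / pochhammer c j / (j`!)%:R.

Lemma hyp_coef0 (R : realType) (a b c : R) : hyp_coef a b c 0 = 1.
Proof. by rewrite /hyp_coef !pochhammer0 fact0 !divr1 mulr1. Qed.

Lemma hyp_coefS (R : realType) (a b c : R) (j : nat) : 0 < c ->
  hyp_coef a b c j.+1 =
  hyp_coef a b c j * ((a + j%:R) * (b + j%:R) / ((c + j%:R) * j.+1%:R)).
Proof.
move=> c0; rewrite /hyp_coef !pochhammerS factS natrM; field.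
have := pochhammer_gt0 j c0; have : 0 < (j`!)%:R :> R by rewrite ltr0n fact_gt0.
have : 0 < c + j%:R by rewrite ltr_wpDr.
by do 3 (move=> /lt0r_neq0 ->); rewrite nat1r pnatr_eq0.
Qed.

Lemma hyp_seriesE (R : realType) (a b c x : R) :
  hyp_series a b c x = limn (pseries (hyp_coef a b c) x).
Proof.
rewrite /hyp_series /pseries; congr (limn (series _)).
by apply/funext => j; rewrite /hyp_term /hyp_coef mulrAC.
Qed.

(* The comparison series [(-1/4)_j / j!] has telescoping partial sums. *)
Lemma hyp_coefN_le (R : realType) (a : R) (j : nat) : `|a| < 2^-1 ->
  `|hyp_coef a (- a) (1 - a) j.+1| <=
  2 * (`|pochhammer (- 4^-1 : R) j.+1| / (j.+1`!)%:R).
Proof.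
rewrite ltr_norml => /andP[a1 a2].
have c0 : 0 < 1 - a by lra.
elim: j => [|j ih].
  (* The factor 2 comes from this coefficient: a^2 / (1 - a) can approach 1/2 = 2 * 1/4. *)
  rewrite hyp_coefS// hyp_coef0 pochhammerS pochhammer0 (_ : 1`! = 1)%N// divr1 !addr0 !mul1r mulr1.
  rewrite normrN [X in 2 * X]ger0_norm; last by lra.
  rewrite normrM normfV (gtr0_norm c0) ler_pdivrMr// mulrN normrN -expr2.
  by rewrite ger0_norm ?sqr_ge0//; nra.
move: ih; rewrite (hyp_coefS _ _ j.+1 c0) (pochhammerS _ j.+1) [j.+2`!]factS natrM.
move: (hyp_coef _ _ _ _) (pochhammer _ _) => u v ih; rewrite !normrM.
have f0 : 0 < (j.+1`!)%:R :> R by rewrite ltr0n fact_gt0.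
move: (j.+1`!)%:R => f in ih f0 *.
have m1 : 1 <= j.+1%:R :> R by rewrite ler1n.
set m := j.+1%:R in m1 *.
have -> : j.+2%:R = m + 1 :> R by rewrite /m natr1.
rewrite !normfV normrM.
rewrite (@ger0_norm _ (a + m)); last lra.
rewrite (@ger0_norm _ (- a + m)); last lra.
rewrite (@ger0_norm _ (1 - a + m)); last lra.
rewrite (@ger0_norm _ (m + 1)); last lra.
rewrite (@ger0_norm _ (- 4^-1 + m)); last lra.
have -> : 2 * (`|v| * (- 4^-1 + m) / ((m + 1) * f)) = 2 * (`|v| / f) * ((- 4^-1 + m) / (m + 1)).
  by field; rewrite !gt_eqF//; lra.
apply: ler_pM => //.
  by apply: divr_ge0; apply: mulr_ge0; lra.
(* For large m the ratio of coefficients is about 1 - (2 - a)/m, against 1 - (5/4)/m for the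
   comparison series; a < 1/2 leaves room. *)
rewrite ler_pdivlMr; last lra.
rewrite -mulrA mulrAC -mulrA.
have -> : (a + m) * ((m + 1) * ((- a + m) / ((1 - a + m) * (m + 1)))) =
  (a + m) * (- a + m) / (1 - a + m) by field; rewrite !gt_eqF//; lra.
rewrite ler_pdivrMr; last lra.
nra.
Qed.

Lemma hyp_seriesN_bound (R : realType) (a x : R) : `|a| < 2^-1 -> `|x| <= 1 ->
  `|hyp_series a (- a) (1 - a) x - 1| <= 2 * `|x|.
Proof.
move=> a1 x1; rewrite hyp_seriesE.
have [|_] := @pseries_sum_bound _ (hyp_coef a (- a) (1 - a)) 2 x _ x1.
  move=> n; apply: (@le_trans _ _ (2 * \sum_(j < n) (`|pochhammer (- 4^-1 : R) j.+1| / (j.+1`!)%:R))).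
    by rewrite mulr_sumr; apply: ler_sum => i _; exact: hyp_coefN_le.
  by rewrite -[leRHS]mulr1 ler_wpM2l// sum_norm_pochhammer//; lra.
by rewrite hyp_coef0.
Qed.

Lemma hyp_seriesN_continuous (R : realType) (a x : R) : `|a| < 2^-1 -> `|x| < 1 ->
  {for x, continuous (hyp_series a (- a) (1 - a))}.
Proof.
move=> a1 x1.
have -> : hyp_series a (- a) (1 - a) = fun y => limn (pseries (hyp_coef a (- a) (1 - a)) y).
  by apply/funext => y; rewrite hyp_seriesE.
apply: (@pseries_continuous _ _ 2) => // -[|i]; first by rewrite hyp_coef0 normr1; lra.
apply: (le_trans (hyp_coefN_le _ a1)); rewrite -[leRHS]mulr1 ler_wpM2l//.
apply: le_trans (@sum_norm_pochhammer R (- 4^-1) i.+1 _); last by lra.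
by rewrite big_ord_recr/= lerDr sumr_ge0// => k _; rewrite divr_ge0.
Qed.

(** The coefficient is (a)_j / (1 - a)_j, and 1 - a >= 1 gives (1 - a)_j >= j!. The bound is
    summable by [sum_norm_pochhammer]. *)
Lemma hyp_coef1_le_fact (R : realType) (a : R) (j : nat) : a <= 0 ->
  `|hyp_coef a 1 (1 - a) j| <= `|pochhammer a j| / (j`!)%:R.
Proof.
move=> a0; have c0 : 0 < 1 - a by lra.
have f0 : 0 < (j`!)%:R :> R by rewrite ltr0n fact_gt0.
rewrite /hyp_coef pochhammer1.
have -> : pochhammer a j * (j`!)%:R / pochhammer (1 - a) j / (j`!)%:R =
  pochhammer a j / pochhammer (1 - a) j.
  by field; rewrite !gt_eqF// pochhammer_gt0.
rewrite normrM normfV (gtr0_norm (pochhammer_gt0 _ c0)) ler_wpM2l//.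
rewrite lef_pV2 ?posrE ?pochhammer_gt0// -pochhammer1.
by apply: ler_prod => i _; rewrite addr_ge0//= lerD2r; lra.
Qed.

Lemma hyp_coef1_ge0 (R : realType) (a : R) (j : nat) : 0 < a < 1 ->
  0 <= hyp_coef a 1 (1 - a) j.
Proof.
move=> /andP[a0 a1]; rewrite /hyp_coef; apply: divr_ge0 => //; apply: divr_ge0.
  by rewrite mulr_ge0// ltW// pochhammer_gt0.
by rewrite ltW// pochhammer_gt0//; lra.
Qed.

(** With m = j + 1 the ratio of consecutive coefficients is 1 - (1 - 2a)/(m - a) <= 1 - (1 - 2a)/m,
    which Bernoulli's inequality compares with (1 + 1/m)^(-(1 - 2a)). *)
Lemma hyp_coef1_le_powR (R : realType) (a : R) (j : nat) : 0 < a < 2^-1 ->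
  hyp_coef a 1 (1 - a) j <= j.+1%:R `^ (- (1 - 2 * a)).
Proof.
move=> /andP[a0 a1]; have c0 : 0 < 1 - a by lra.
elim: j => [|j ih]; first by rewrite hyp_coef0 powR1.
rewrite hyp_coefS//.
have j0 : 0 < j.+1%:R :> R by rewrite ltr0n.
have -> : j.+2%:R = j.+1%:R * (1 + j.+1%:R^-1) :> R.
  by rewrite mulrDr mulr1 divff ?gt_eqF// natr1.
rewrite powRM ?addr_ge0 ?invr_ge0//.
have -> : 1 + j%:R = j.+1%:R :> R by rewrite nat1r.
have -> : a + j%:R = j.+1%:R - (1 - a) by rewrite -nat1r; ring.
have -> : 1 - a + j%:R = j.+1%:R - a by rewrite -nat1r; ring.
have j1 : 1 <= j.+1%:R :> R by rewrite ler1n.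
set m := j.+1%:R in ih j0 j1 *.
apply: ler_pM => //.
- by apply: hyp_coef1_ge0; lra.
- by apply: divr_ge0; apply: mulr_ge0; lra.
have im0 : 0 <= m^-1 by rewrite invr_ge0 ltW.
apply: le_trans (powRN_bernoulli im0 _); last by lra.
have -> : (m - (1 - a)) * m / ((m - a) * m) = (m - (1 - a)) / (m - a).
  by field; rewrite !gt_eqF//; lra.
rewrite ler_pdivrMr; last lra.
have -> : (1 - (1 - 2 * a) / m) * (m - a) = m - (1 - a) + a * (1 - 2 * a) / m.
  by field; rewrite gt_eqF.
by rewrite lerDl; apply: divr_ge0; [apply: mulr_ge0|]; lra.
Qed.

Lemma hyp_coef1_bounded (R : realType) (a : R) (j : nat) : `|a| < 2^-1 ->
  `|hyp_coef a 1 (1 - a) j| <= 1.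
Proof.
rewrite ltr_norml => /andP[a1 a2].
have [a0|a0] := leP a 0.
  case: j => [|j]; first by rewrite hyp_coef0 normr1.
  apply: le_trans (hyp_coef1_le_fact _ a0) _.
  apply: le_trans (@sum_norm_pochhammer R a j.+1 _); last by lra.
  by rewrite big_ord_recr/= lerDr sumr_ge0// => k _; rewrite divr_ge0.
rewrite ger0_norm; last by apply: hyp_coef1_ge0; lra.
apply: le_trans (hyp_coef1_le_powR _ _) _; first by rewrite a0.
rewrite -[leRHS](one_powR (- (1 - 2 * a))); apply: le_powRN; rewrite ?ler1n//; lra.
Qed.

Lemma hyp_series1_continuous (R : realType) (a x : R) : `|a| < 2^-1 -> `|x| < 1 ->
  {for x, continuous (hyp_series a 1 (1 - a))}.
Proof.
move=> a1 x1.
have -> : hyp_series a 1 (1 - a) = fun y => limn (pseries (hyp_coef a 1 (1 - a)) y).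
  by apply/funext => y; rewrite hyp_seriesE.
by apply: (@pseries_continuous _ _ 1) => // i; exact: hyp_coef1_bounded.
Qed.

Lemma hyp_series1_bound_le0 (R : realType) (a y : R) : - 2^-1 < a <= 0 -> `|y| <= 1 ->
  `|hyp_series a 1 (1 - a) y| <= 2.
Proof.
move=> /andP[a1 a0] y1; rewrite hyp_seriesE.
have [|_] := @pseries_sum_bound _ (hyp_coef a 1 (1 - a)) 1 y _ y1.
  move=> n; apply: le_trans (@sum_norm_pochhammer R a n _); last by lra.
  by apply: ler_sum => i _; exact: hyp_coef1_le_fact.
rewrite hyp_coef0; set l := limn _ => h.
by rewrite -[l](subrK 1); apply: le_trans (ler_normD _ _) _; rewrite normr1; lra.
Qed.

(* For [n] close to [1 / (1 - y)], the terms before [n] are summed without the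
   factor [y ^+ j], and the terms after [n] as a geometric series. *)
Lemma sum_powR_geometric_le (R : realType) (b y : R) (N : nat) : 0 < b < 1 -> 0 <= y < 1 ->
  \sum_(j < N) j.+1%:R `^ (- (1 - b)) * y ^+ j <= (2 / b + 1) * (1 - y) `^ (- b).
Proof.
move=> /andP[b0 b1] /andP[y0 y1].
have s0 : 0 < 1 - y by rewrite subr_gt0.
set s := 1 - y in s0 *.
have [n /andP[n1 n2]] : exists n : nat, s^-1 <= n%:R <= 2 * s^-1.
  have h : 1 <= s^-1 by rewrite invf_ge1// /s lerBlDr lerDl.
  exists (Num.truncn s^-1).+1.
  have /andP[t1 t2] : (Num.truncn s^-1)%:R <= s^-1 < (Num.truncn s^-1).+1%:R.
    by apply: truncn_itv; lra.
  by rewrite ltW//= -natr1; lra.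
have n0 : 0 < n%:R :> R by apply: lt_le_trans n1; rewrite invr_gt0.
have h j : (j.+1%:R : R) `^ (- (1 - b)) * y ^+ j <=
   (if (j < n)%N then (j.+1%:R : R) `^ (- (1 - b)) else 0) + s^-1 `^ (- (1 - b)) * y ^+ j.
  have yj0 : 0 <= y ^+ j by rewrite exprn_ge0.
  case: ltnP => jn.
    apply: (@le_trans _ _ (j.+1%:R `^ (- (1 - b)))).
      by rewrite -[leRHS]mulr1 ler_wpM2l ?powR_ge0// exprn_ile1// ltW.
    by rewrite lerDl mulr_ge0// powR_ge0.
  rewrite add0r ler_wpM2r//; apply: le_powRN; rewrite ?invr_gt0//; last by lra.
  by apply: le_trans n1 _; rewrite ler_nat ltnW.
apply: (le_trans (y := \sum_(j < N) _)); first by apply: ler_sum => j _; exact: h.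
rewrite big_split/= mulrDl lerD//.
  rewrite -big_mkcond/=.
  apply: (@le_trans _ _ (\sum_(i < n) (i.+1%:R : R) `^ (- (1 - b)))).
    rewrite (big_ord_widen_cond (maxn N n) (fun i => i < n)%N
      (fun i => (i.+1%:R : R) `^ (- (1 - b)))) ?leq_maxl//.
    rewrite (big_ord_widen (maxn N n) (fun i => (i.+1%:R : R) `^ (- (1 - b)))) ?leq_maxr//.
    rewrite [leLHS]big_mkcond [leRHS]big_mkcond/=.
    apply: ler_sum => i _; case: (i < n)%N => //=.
    by case: ifP => // _; rewrite powR_ge0.
  apply: le_trans (sum_powRN_le _ _) _; first by lra.
  rewrite opprB addrC subrK mulrAC ler_pM2r ?invr_gt0//.
  apply: (@le_trans _ _ ((2 * s^-1) `^ b)).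
    by apply: ge0_ler_powR; rewrite ?nnegrE ?mulr_ge0 ?invr_ge0// ltW.
  rewrite powRM ?invr_ge0 ?(ltW s0)// powRN -powR_inv1 ?(ltW s0)// -powRrM mulN1r powRN.
  rewrite ler_pM2r ?invr_gt0 ?powR_gt0//.
  by rewrite -[leRHS]powRr1//; apply: ler_powR; lra.
rewrite mul1r -mulr_sumr.
have -> : s `^ (- b) = s^-1 `^ (- (1 - b)) * s^-1.
  rewrite -powR_inv1 ?(ltW s0)// -powRrM -powRD; last by rewrite (gt_eqF s0) implybT.
  by congr (_ `^ _); ring.
rewrite ler_pM2l ?powR_gt0 ?invr_gt0//.
rewrite -[leRHS]mul1r ler_pdivlMr// mulrC.
by rewrite /s -opprB mulNr -subrX1 opprB lerBlDr lerDl exprn_ge0.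
Qed.

(** The exponent is that of the hypergeometric singularity at 1: c - a - b = -2a for the parameters
    (a, 1, 1 - a). The sum is [sum_powR_geometric_le] with b = 2a. *)
Lemma hyp_series1_bound_gt0 (R : realType) (a y : R) : 0 < a < 2^-1 -> 0 <= y < 1 ->
  `|hyp_series a 1 (1 - a) y| <= (a^-1 + 1) * (1 - y) `^ (- (2 * a)).
Proof.
move=> /andP[a0 a1] /andP[y0 y1]; rewrite hyp_seriesE.
have cv : cvgn (pseries (hyp_coef a 1 (1 - a)) y).
  apply: (@pseries_bounded_cvg _ _ 1 1) => [i|]; last by rewrite ger0_norm.
  by rewrite expr1n mulr1 hyp_coef1_bounded// ltr_norml; lra.
have cv2 : (fun n => `|pseries (hyp_coef a 1 (1 - a)) y n|) @ \oo -->
   `|limn (pseries (hyp_coef a 1 (1 - a)) y)| by exact: cvg_norm.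
rewrite -(cvg_lim _ cv2)//; apply: limr_le; first by apply/cvg_ex; eexists; exact: cv2.
apply: nearW => n; rewrite /pseries /series/= big_mkord.
apply: le_trans (ler_norm_sum _ _ _) _.
have -> : a^-1 = 2 / (2 * a) by field; rewrite gt_eqF.
have y01 : 0 <= y < 1 by rewrite y0.
apply: le_trans (@sum_powR_geometric_le R (2 * a) y n _ y01); last by lra.
apply: ler_sum => i _; rewrite normrM normrX (ger0_norm y0) ler_wpM2r ?exprn_ge0//.
rewrite ger0_norm; last by apply: hyp_coef1_ge0; lra.
by apply: hyp_coef1_le_powR; rewrite a0.
Qed.

Lemma zH_right (R : realType) (H s : R) : 2^-1 < s < 1 ->
  let a := 2^-1 - H in
  zH H 1 s = cH H * (1 - s) `^ (- a) * hyp_series a (- a) (1 - a) ((s - 1) / s).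
Proof.
move=> /andP[s1 s2] a; have s0 : 0 < s by lra.
rewrite /zH s0 s2/= /hypgeom ifT; last by rewrite ltr_pdivlMr//; lra.
by congr (_ * _ `^ _ * hyp_series _ _ _ _); rewrite /a; lra.
Qed.

(** This is the Pfaff branch, since x = (s - 1)/s <= -1 exactly when s <= 1/2. There x/(x - 1) = 1 -
    s and (1 - x)^(-a) = s^a. *)
Lemma zH_left (R : realType) (H s : R) : 0 < s <= 2^-1 ->
  let a := 2^-1 - H in
  zH H 1 s = cH H * (1 - s) `^ (- a) * (s `^ a * hyp_series a 1 (1 - a) (1 - s)).
Proof.
move=> /andP[s0 s1] a; have s2 : s < 1 by lra.
rewrite /zH s0 s2/= /hypgeom ifF; last first.
  by apply/negbTE; rewrite -leNgt ler_pdivrMr//; lra.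
have -> : 1 - (s - 1) / s = s^-1 by field; rewrite gt_eqF.
have -> : (s - 1) / s / ((s - 1) / s - 1) = 1 - s.
  have -> : (s - 1) / s - 1 = - s^-1 by field; rewrite gt_eqF.
  by rewrite invrN invrK mulrN divfK ?gt_eqF// opprB.
congr (_ * _ `^ _ * (_ * hyp_series _ _ _ _)); rewrite /a ?opprB; try lra.
by rewrite -powR_inv1 ?(ltW s0)// -powRrM; congr (_ `^ _); ring.
Qed.

Lemma zH_scale (R : realType) (H t s : R) : 0 < t ->
  zH H t s = t `^ (H - 2^-1) * zH H 1 (s / t).
Proof.
move=> t0; rewrite /zH pmulr_lgt0 ?invr_gt0// ltr_pdivrMr// mul1r.
case: ifPn => [/andP[s0 st]|]; last by rewrite mulr0.
have -> : (s / t - 1) / (s / t) = (s - t) / s by field; rewrite !gt_eqF.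
have -> : t - s = t * (1 - s / t) by field; rewrite gt_eqF.
rewrite powRM ?(ltW t0)// ?subr_ge0 ?ler_pdivrMr ?mul1r ?(ltW st)//.
by ring.
Qed.

(** Right of 1/2 the series is bounded, which leaves (1 - s)^(-a). Left of 1/2 the factor s^a meets
    a bounded series if a <= 0 and one of order s^(-2a) if a > 0. So the kernel is at most of order
    min(s, 1 - s)^(-|a|). *)
Lemma zH_bound (R : realType) (H : R) : 0 < H < 1 ->
  exists2 D : R, 0 < D & forall s, 0 < s < 1 ->
    zH H 1 s ^+ 2 <= D * Num.min s (1 - s) `^ (- (2 * `|2^-1 - H|)).
Proof.
move=> /andP[H0 H1]; set a := 2^-1 - H.
have a1 : `|a| < 2^-1 by rewrite ltr_norml /a; lra.
have na : a <= `|a| by exact: ler_norm.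
have na' : - a <= `|a| by rewrite -normrN ler_norm.
have na0 : 0 <= `|a| by [].
(* [C] bounds the left half; for a > 0 its factor 2 is for (1 - s)^(-a) <= 2. On the right half the
   series is at most 3 <= C + 1. *)
pose C := if a <= 0 then 2 else 2 * (a^-1 + 1).
have C2 : 2 <= C.
  rewrite /C; case: ifPn => // ; rewrite -ltNge => a0.
  have : 0 < a^-1 by rewrite invr_gt0.
  lra.
have key (s m w : R) : 0 < m -> `|w| <= (C + 1) * m `^ (- `|a|) ->
    (cH H * w) ^+ 2 <= (cH H ^+ 2 * (C + 1) ^+ 2 + 1) * m `^ (- (2 * `|a|)).
  move=> m0 hw; rewrite exprMn.
  have hw2 : w ^+ 2 <= (C + 1) ^+ 2 * m `^ (- (2 * `|a|)).
    rewrite -[w ^+ 2]real_normK ?num_real//.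
    have -> : m `^ (- (2 * `|a|)) = (m `^ (- `|a|)) ^+ 2.
      by rewrite -powR_mulrn ?powR_ge0// -powRrM; congr (_ `^ _); ring.
    rewrite -exprMn lerXn2r ?nnegrE//.
    by rewrite mulr_ge0 ?powR_ge0//; lra.
  have := ler_wpM2l (sqr_ge0 (cH H)) hw2.
  have := powR_ge0 m (- (2 * `|a|)).
  set M := m `^ _; nra.
exists (cH H ^+ 2 * (C + 1) ^+ 2 + 1); first by rewrite ltr_pwDr// mulr_ge0// sqr_ge0.
move=> s /andP[s0 s1]; have u0 : 0 < 1 - s by lra.
have le1 (x q : R) : 0 < x <= 1 -> 0 <= q -> x `^ q <= 1.
  move=> /andP[x0 x1] q0; rewrite -[leRHS](one_powR q).
  by apply: ge0_ler_powR; rewrite ?nnegrE// ltW.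
have [s2|s2] := leP s 2^-1.
- rewrite zH_left ?s0// -/a min_l; last by lra.
  rewrite -mulrA; apply: key => //.
  rewrite normrM (ger0_norm (powR_ge0 _ _)) normrM (ger0_norm (powR_ge0 _ _)).
  have [a0|a0] := leP a 0.
    have -> : C = 2 by rewrite /C a0.
    rewrite (ler0_norm a0) opprK.
    have h1 : (1 - s) `^ (- a) <= 1 by apply: le1; lra.
    have h2 : `|hyp_series a 1 (1 - a) (1 - s)| <= 2.
      by apply: hyp_series1_bound_le0; rewrite ?ger0_norm; rewrite ?ltr_norml /a in a1 a0 *; lra.
    have p0 := powR_ge0 s a; have q0 := powR_ge0 (1 - s) (- a).
    have n0 := normr_ge0 (hyp_series a 1 (1 - a) (1 - s)).
    apply: (@le_trans _ _ (1 * (s `^ a * 2))); last by lra.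
    by apply: ler_pM => //; [apply: mulr_ge0|apply: ler_wpM2l].
  have -> : C = 2 * (a^-1 + 1) by rewrite /C leNgt a0.
  rewrite (gtr0_norm a0).
  have h1 : (1 - s) `^ (- a) <= 2.
    apply: (@le_trans _ _ (2^-1 `^ (- a))); first by apply: le_powRN; lra.
    rewrite -powR_inv1// -powRrM mulrN mulN1r opprK -[leRHS]powRr1//.
    by apply: ler_powR; lra.
  have h2 : `|hyp_series a 1 (1 - a) (1 - s)| <= (a^-1 + 1) * s `^ (- (2 * a)).
    have := @hyp_series1_bound_gt0 R a (1 - s); rewrite subKr.
    by apply; rewrite ?ltr_norml in a1 *; lra.
  have e : s `^ (- a) = s `^ a * s `^ (- (2 * a)).
    by rewrite -powRD ?(gt_eqF s0) ?implybT//; congr (_ `^ _); ring.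
  have p0 := powR_ge0 s a; have q0 := powR_ge0 (1 - s) (- a).
  have n0 := normr_ge0 (hyp_series a 1 (1 - a) (1 - s)).
  apply: (@le_trans _ _ (2 * (s `^ a * ((a^-1 + 1) * s `^ (- (2 * a)))))).
    by apply: ler_pM => //; [apply: mulr_ge0|apply: ler_wpM2l].
  rewrite e mulrCA; set w := s `^ a; set w' := s `^ (- _).
  rewrite [leRHS]mulrA [leRHS]mulrAC.
  have : 0 <= w * w' by rewrite mulr_ge0 ?powR_ge0.
  set iv := a^-1; nra.
- rewrite zH_right ?s2// -/a min_r; last by lra.
  rewrite -mulrA; apply: key => //.
  rewrite normrM (ger0_norm (powR_ge0 _ _)).
  have x1 : `|(s - 1) / s| <= 1.
    by rewrite normrM normfV (gtr0_norm s0) ler_pdivrMr// mul1r ler0_norm; lra.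
  have := hyp_seriesN_bound a1 x1; set F := hyp_series _ _ _ _ => hF.
  have F3 : `|F| <= 3.
    by rewrite -[F](subrK 1); apply: le_trans (ler_normD _ _) _; rewrite normr1; lra.
  rewrite mulrC; apply: ler_pM => //; rewrite ?powR_ge0//; first by lra.
  rewrite /powR (gt_eqF u0) ler_expR ler_wnM2r//; last by lra.
  by rewrite -(ln1) ler_ln ?posrE//; lra.
Qed.

(** At 1/2 the two branches of [hypgeom] meet, and agreement of their limits there would require
    Pfaff's identity. The approximation by step functions can leave out a single point. *)
Lemma zH_continuous (R : realType) (H s : R) : 0 < H < 1 -> 0 < s < 1 -> s != 2^-1 ->
  {for s, continuous (zH H 1)}.
Proof.
move=> /andP[H0 H1] /andP[s0 s1] s2; set a := 2^-1 - H.
have a1 : `|a| < 2^-1 by rewrite ltr_norml /a; lra.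
have c1 : {for s, continuous (fun x : R => (1 - x) `^ (- a))}.
  apply: (@continuous_comp _ _ _ (fun x : R => 1 - x) (fun y => y `^ (- a))).
    by apply: continuousB; [exact: cst_continuous|exact: cvg_id].
  by apply: powR_continuous; lra.
have cc : {for s, continuous (fun _ : R => cH H)} by exact: cst_continuous.
have [s3|s3] := ltP s 2^-1.
- have c2 : {for s, continuous (fun x : R => x `^ a)} by apply: powR_continuous.
  have c3 : {for s, continuous (fun x : R => hyp_series a 1 (1 - a) (1 - x))}.
    apply: (@continuous_comp _ _ _ (fun x : R => 1 - x) (hyp_series a 1 (1 - a))).
      by apply: continuousB; [exact: cst_continuous|exact: cvg_id].
    by apply: hyp_series1_continuous => //; rewrite ger0_norm; lra.
  have c4 := continuousM (continuousM cc c1) (continuousM c2 c3).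
  rewrite /prop_for /continuous_at zH_left ?s0 ?(ltW s3)// -/a.
  apply: cvg_trans c4; apply: near_eq_cvg.
  near=> x; rewrite /= zH_left//; apply/andP; split; last apply: ltW.
    by near: x; exact: lt_nbhsr.
  by near: x; exact: lt_nbhsl.
- have s4 : 2^-1 < s by rewrite lt_neqAle eq_sym s2.
  have c3 : {for s, continuous (fun x : R => hyp_series a (- a) (1 - a) ((x - 1) / x))}.
    apply: (@continuous_comp _ _ _ (fun x : R => (x - 1) / x) (hyp_series a (- a) (1 - a))).
      apply: continuousM.
        by apply: continuousB; [exact: cvg_id|exact: cst_continuous].
      by apply: continuousV; [rewrite gt_eqF|exact: cvg_id].
    apply: hyp_seriesN_continuous => //.
    by rewrite normrM normfV (gtr0_norm s0) ltr_pdivrMr// mul1r ler0_norm; lra.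
  have c4 := continuousM (continuousM cc c1) c3.
  rewrite /prop_for /continuous_at zH_right ?s4// -/a.
  apply: cvg_trans c4; apply: near_eq_cvg.
  near=> x; rewrite /= zH_right//; apply/andP; split.
    by near: x; exact: lt_nbhsr.
  by near: x; exact: lt_nbhsl.
Unshelve. all: by end_near. Qed.

(** On this interval |(s - 1)/s| <= 1/4, so the series is at least 1/2; and (1 - s)^(-a) >= 1 - s >=
    1/10. Hence the factor 1/20. *)
Lemma zH_lower (R : realType) (H s : R) : 0 < H < 1 -> 4 / 5 <= s <= 9 / 10 -> 0 <= cH H ->
  cH H / 20 <= zH H 1 s.
Proof.
move=> /andP[H0 H1] /andP[s1 s2] c0; set a := 2^-1 - H.
have a1 : `|a| < 2^-1 by rewrite ltr_norml /a; lra.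
have s0 : 0 < s by lra.
rewrite zH_right -/a; last by lra.
have x1 : `|(s - 1) / s| <= 4^-1.
  by rewrite normrM normfV (gtr0_norm s0) ler_pdivrMr// ler0_norm; lra.
have x2 : `|(s - 1) / s| <= 1 by lra.
have := hyp_seriesN_bound a1 x2; set F := hyp_series _ _ _ _.
rewrite ler_norml => /andP[hF _].
have F2 : 2^-1 <= F by lra.
have p1 : 10^-1 <= (1 - s) `^ (- a).
  apply: (@le_trans _ _ (1 - s)); first by lra.
  by apply: ger1_powR; rewrite ?ltr_norml in a1 *; lra.
rewrite -mulrA ler_wpM2l//; apply: (@le_trans _ _ (10^-1 * 2^-1)); first by lra.
by apply: ler_pM.
Qed.

(** * Approximation by step functions on regular grids *)

Definition grid_l (R : realType) (h : R) (n : nat) (i : 'I_n) : R := i%:R * h.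
Definition grid_r (R : realType) (h : R) (n : nat) (i : 'I_n) : R := i.+1%:R * h.

(* Of the endpoints of the [i]-th of [2 * N] cells, the one nearer to the midpoint
   of the whole interval: a U-shaped majorant at a point of the cell is then also a
   majorant at the tag. *)
Definition tag (R : realType) (h : R) (N n : nat) (i : 'I_n) : R :=
  (if (i < N)%N then i.+1%:R else i%:R) * h.

Lemma stepfun_cell (R : realType) (h : R) (n : nat) (a : 'I_n -> R) (i : 'I_n) (x : R) :
  0 < h -> i%:R * h < x <= i.+1%:R * h ->
  stepfun a (@grid_l R h n) (@grid_r R h n) x = a i.
Proof.
move=> h0 /andP[x1 x2]; rewrite /stepfun (bigD1 i)//= /grid_l /grid_r x1 x2/=.
rewrite big1 ?addr0// => j ji; case: ifPn => // /andP[y1 y2].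
have : (i%:R : R) * h < j.+1%:R * h by apply: lt_le_trans y2.
have : (j%:R : R) * h < i.+1%:R * h by apply: lt_le_trans x2.
rewrite !ltr_pM2r// !ltr_nat !ltnS => ij ji'.
by move: ji; rewrite -val_eqE/= eqn_leq ij ji'.
Qed.

Lemma stepfun_out (R : realType) (h : R) (n : nat) (a : 'I_n -> R) (x : R) :
  0 < h -> ~~ (0 < x <= n%:R * h) ->
  stepfun a (@grid_l R h n) (@grid_r R h n) x = 0.
Proof.
move=> h0 hx; rewrite /stepfun big1// => i _; case: ifPn => // /andP[y1 y2].
exfalso; apply/negP: hx; rewrite negbK; apply/andP; split.
  by apply: le_lt_trans y1; rewrite mulr_ge0// ltW.
by apply: le_trans y2 _; rewrite ler_pM2r// ler_nat.
Qed.

Lemma cell_exists (R : realType) (h : R) (n : nat) (x : R) :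
  0 < h -> 0 < x <= n%:R * h -> exists i : 'I_n, i%:R * h < x <= i.+1%:R * h.
Proof.
move=> h0; elim: n => [|n ih] /andP[x0 xn]; first by move: xn; rewrite mul0r; lra.
have [xn'|xn'] := leP x (n%:R * h); last by exists ord_max; rewrite xn' xn.
by have [|i hi] := ih; [rewrite x0 xn'|exists (widen_ord (leqnSn n) i)].
Qed.

Lemma tag_near (R : realType) (h : R) (N n : nat) (i : 'I_n) (x : R) :
  0 < h -> i%:R * h < x <= i.+1%:R * h -> `|tag h N i - x| <= h.
Proof.
rewrite /tag -natr1 mulrDl mul1r ler_norml => h0 /andP[x1 x2].
by case: ifP => _; rewrite ?mulrDl ?mul1r; lra.
Qed.

Lemma tag_min (R : realType) (h : R) (N : nat) (i : 'I_(2 * N)) (x : R) :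
  0 < h -> i%:R * h < x <= i.+1%:R * h ->
  Num.min x ((2 * N)%:R * h - x) <= Num.min (tag h N i) ((2 * N)%:R * h - tag h N i).
Proof.
move=> h0 /andP[x1 x2]; rewrite /tag natrM.
case: ltnP => iN.
  have h1 : i.+1%:R * h <= N%:R * h by rewrite ler_pM2r// ler_nat.
  by rewrite [leRHS]min_l; [rewrite ge_min; lra|lra].
have h1 : N%:R * h <= i%:R * h by rewrite ler_pM2r// ler_nat.
by rewrite [leRHS]min_r; [rewrite ge_min; lra|lra].
Qed.

Lemma tag_itv (R : realType) (h : R) (N : nat) (i : 'I_(2 * N)) : 0 < h ->
  0 < tag h N i < (2 * N)%:R * h.
Proof.
move=> h0; have i2 := ltn_ord i; rewrite /tag.
case: ltnP => iN; rewrite ltr_pM2r// ltr_nat pmulr_lgt0// ltr0n/=; lia.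
Qed.

Lemma stepfun_measurable (R : realType) (n : nat) (a l r : 'I_n -> R) :
  measurable_fun setT (stepfun a l r).
Proof.
rewrite (_ : stepfun a l r = fun x => \sum_(i < n) a i * \1_(`]l i, r i]%classic) x).
  by apply: measurable_sum => i; apply: measurable_funM => //.
apply/funext => x; apply: eq_bigr => i _; rewrite indicE mem_setE in_itv/=.
by case: ifP => _; rewrite ?mulr1 ?mulr0.
Qed.

Lemma measurable_nneg (R : realType) : measurable [set x : R | 0 <= x].
Proof.
rewrite (_ : [set _ | _] = `[0, +oo[%classic); first exact: measurable_itv.
by apply/seteqP; split=> x /=; rewrite in_itv/= andbT.
Qed.

Lemma integral_stepfun_grid (R : realType) (h : R) (n : nat) (a : 'I_n -> R) :
  0 < h -> (forall i, 0 <= a i) ->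
  (\int[@lebesgue_measure R]_(x in [set x : R | (0 <= x)%R])
     (stepfun a (@grid_l R h n) (@grid_r R h n) x)%:E = ((\sum_(i < n) a i) * h)%:E)%E.
Proof.
move=> h0 a0; rewrite /stepfun.
under eq_integral do rewrite -sumEFin.
have mD := @measurable_nneg R.
have e i : (fun x : R => (if (@grid_l R h n i < x) && (x <= @grid_r R h n i) then a i else 0)%:E) =
   (fun x => (a i)%:E * (\1_(`]@grid_l R h n i, @grid_r R h n i]%classic) x)%:E)%E.
  apply/funext => x; rewrite indicE mem_setE in_itv/=.
  by case: ifP => _; rewrite ?mule1 ?mule0.
rewrite ge0_integral_sum//; last 2 first.
- by move=> i; rewrite e; apply/measurable_EFinP/measurable_funM.
- by move=> i x _; rewrite lee_fin; case: ifP.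
rewrite mulr_suml -sumEFin; apply: eq_bigr => i _; rewrite e.
rewrite ge0_integralZl//; last 2 first.
- by apply/measurable_EFinP; apply: measurable_indic.
- by rewrite lee_fin.
rewrite integral_indic//.
rewrite (_ : _ `&` _ = `]@grid_l R h n i, @grid_r R h n i]%classic); last first.
  apply/setIidPl => x /=; rewrite in_itv/= => /andP[x1 _].
  by apply: ltW; apply: le_lt_trans x1; rewrite mulr_ge0// ltW.
apply: (etrans (congr1 (fun z => (a i)%:E * z)%E (lebesgue_measure_itv _))).
rewrite /= lte_fin ltr_pM2r// ltr_nat ltnSn -EFinB -EFinM.
by congr (_ * _)%:E; rewrite -mulrBl -natr1; lra.
Qed.

(** The numbers of cells are multiples of 2p. Taking for p the numerator of a rational t makes the
    mesh the inverse of an integer. *)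
Lemma stepfun_tag_cvg (R : realType) (t : R) (p : nat) (f : R -> R) (x : R) :
  0 < t -> (0 < p)%N -> 0 < x < t -> {for x, continuous f} ->
  (fun k => let N := (p * k.+1)%N in let h := t / (2 * N)%:R in
    stepfun (fun i : 'I_(2 * N) => f (tag h N i)) (@grid_l R h _) (@grid_r R h _) x) @ \oo --> f x.
Proof.
move=> t0 p0 /andP[x0 xt] cf.
apply/cvgrPdist_le => e e0.
have /cvgrPdist_le/(_ e e0)/nbhs_ballP[d /= d0 hd] := cf.
near=> k => /=.
set N := (p * k.+1)%N; set h := t / (2 * N)%:R.
have N0 : (0 < 2 * N)%N by rewrite muln_gt0/= /N muln_gt0 p0.
have h0 : 0 < h by rewrite divr_gt0// ltr0n.
have te : (2 * N)%:R * h = t by rewrite mulrC divfK// pnatr_eq0 -lt0n.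
have [|i hi] := @cell_exists R h (2 * N) x h0; first by rewrite x0 te ltW.
rewrite (stepfun_cell _ h0 hi); apply: hd.
rewrite /ball/= distrC; apply: le_lt_trans (tag_near N h0 hi) _.
rewrite /h ltr_pdivrMr ?ltr0n// mulrC -ltr_pdivrMr//.
apply: (@lt_le_trans _ _ k%:R); last first.
  by rewrite ler_nat /N mulnA; apply: leq_trans (leq_pmull _ _) => //; rewrite muln_gt0.
by near: k; exact: nbhs_infty_gtr.
Unshelve. all: by end_near. Qed.

(** Up to a constant this majorizes z_H(t, .)^2, with p = |1 - 2H| < 1. Division by t makes its
    values at the tags depend only on the index and the number of cells. *)
Definition ushape (R : realType) (t p x : R) : R := (Num.min x (t - x) / t) `^ (- p).

(** The distance of a tag from the nearer end is an integer multiple of h: i + 1 cells on the left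
    half, 2N - i cells on the right half, which is the mirror image under [rev_ord]. *)
Lemma tag_ushape (R : realType) (h p : R) (N : nat) (i : 'I_(2 * N)) :
  0 < h -> (0 < N)%N ->
  ushape ((2 * N)%:R * h) p (tag h N i) =
  (2 * N)%:R `^ p * (if (i < N)%N then i.+1%:R else (rev_ord i).+1%:R) `^ (- p).
Proof.
move=> h0 N0; have i2 := ltn_ord i.
have n0 : 0 < (2 * N)%:R :> R by rewrite ltr0n muln_gt0.
have e : Num.min (tag h N i) ((2 * N)%:R * h - tag h N i) =
    (if (i < N)%N then i.+1%:R else (rev_ord i).+1%:R) * h.
  rewrite /tag; case: ltnP => iN.
    have h1 : (i.+1%:R : R) * h <= N%:R * h by rewrite ler_pM2r// ler_nat.
    by rewrite min_l// natrM; lra.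
  have h1 : (N%:R : R) * h <= i%:R * h by rewrite ler_pM2r// ler_nat.
  rewrite min_r; last by rewrite natrM; lra.
  by rewrite -mulrBl -natrB ?(ltnW i2)//; congr (_%:R * _) => /=; lia.
rewrite /ushape e; set c := (if _ then _ else _).
have c0 : 0 <= c by rewrite /c; case: ifP.
have -> : c * h / ((2 * N)%:R * h) = (2 * N)%:R^-1 * c.
  by rewrite invfM mulrACA divff ?gt_eqF// mulr1 mulrC.
rewrite powRM ?invr_ge0// -powR_inv1// -powRrM mulN1r opprK//.
Qed.

(** Each half contributes the same power sum, and no tag is an end of the interval; so the Riemann
    sums are bounded independently of the mesh. The estimate 2^p <= 2 gives the constant. *)
Lemma sum_tag_ushape (R : realType) (h p : R) (N : nat) :
  0 < h -> (0 < N)%N -> 0 <= p < 1 ->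
  (\sum_(i < 2 * N) ushape ((2 * N)%:R * h) p (tag h N i)) * h <=
  2 * ((2 * N)%:R * h) / (1 - p).
Proof.
move=> h0 N0 /andP[p0 p1].
under eq_bigr do rewrite tag_ushape//.
pose w (k : nat) : R := k.+1%:R `^ (- p).
have wN : \sum_(i < 2 * N) (if (i < N)%N then w i else 0) = \sum_(i < N) w i.
  by rewrite (big_ord_widen (2 * N) w) ?leq_pmull// [RHS]big_mkcond.
have -> : \sum_(i < 2 * N) (2 * N)%:R `^ p *
      (if (i < N)%N then i.+1%:R else (rev_ord i).+1%:R) `^ (- p) =
    (2 * N)%:R `^ p * (2 * \sum_(i < N) w i).
  rewrite -mulr_sumr; congr (_ * _).
  rewrite (eq_bigr (fun i : 'I_(2 * N) => (if (i < N)%N then w i else 0) +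
     (if (rev_ord i < N)%N then w (rev_ord i) else 0))); last first.
    move=> i _ /=; have i2 := ltn_ord i; rewrite /w.
    case: (ltnP i N) => iN; case: ltnP => jN; rewrite ?addr0 ?add0r//; exfalso; lia.
  rewrite big_split/= wN -wN.
  rewrite [X in _ + X](reindex_inj rev_ord_inj)/=.
  under [X in _ + X]eq_bigr => i _ do rewrite -[(_ - _)%N]/(nat_of_ord (rev_ord (rev_ord i))) rev_ordK.
  by rewrite mulr_natl mulr2n.
apply: (@le_trans _ _ (2 * N%:R `^ p * (2 * (N%:R `^ (1 - p) / (1 - p))) * h)).
  rewrite ler_pM2r//; apply: ler_pM.
  - exact: powR_ge0.
  - by rewrite mulr_ge0// sumr_ge0// => i _; exact: powR_ge0.
  - rewrite natrM powRM// ler_wpM2r ?powR_ge0//.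
    by apply: (le_trans (ler_powR _ (ltW p1))); rewrite ?powRr1// ler1n.
  - by rewrite ler_wpM2l// sum_powRN_le// p0.
rewrite le_eqVlt; apply/orP; left; apply/eqP.
have -> : 2 * N%:R `^ p * (2 * (N%:R `^ (1 - p) / (1 - p))) * h =
  2 * 2 * (N%:R `^ p * N%:R `^ (1 - p)) * h / (1 - p) by ring.
rewrite -powRD; last by rewrite pnatr_eq0 -lt0n N0 implybT.
by rewrite addrC subrK powRr1// natrM; ring.
Qed.

Lemma ushape_continuous (R : realType) (t p x : R) : 0 < x < t ->
  {for x, continuous (ushape t p)}.
Proof.
move=> /andP[x0 xt].
apply: (@continuous_comp _ _ _ (fun y : R => Num.min y (t - y) / t) (fun z : R => z `^ (- p))).
  apply: continuousM; last exact: cst_continuous.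
  apply: continuous_min; first exact: cvg_id.
  by apply: continuousB; [exact: cst_continuous|exact: cvg_id].
apply: powR_continuous; rewrite divr_gt0//; last by lra.
by rewrite lt_min x0/=; lra.
Qed.

Lemma ushape_ge0 (R : realType) (t p x : R) : 0 <= ushape t p x.
Proof. exact: powR_ge0. Qed.

Lemma ushape_measurable (R : realType) (t p : R) : measurable_fun setT (ushape t p).
Proof.
apply: (measurableT_comp (measurable_powR _)); apply: measurable_funM => //.
by apply: measurable_minr => //; apply: measurable_funB.
Qed.

(* Fatou's lemma, applied to the step functions that take the values at the tags. *)
Lemma integral_ushape (R : realType) (t p : R) : 0 < t -> 0 <= p < 1 ->
  (\int[@lebesgue_measure R]_(x in `]0%R, t[) (ushape t p x)%:E <= (2 * t / (1 - p))%:E)%E.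
Proof.
move=> t0 p01.
pose N k := (1 * k.+1)%N; pose h k : R := t / (2 * N k)%:R.
pose f k := stepfun (fun i : 'I_(2 * N k) => ushape t p (tag (h k) (N k) i))
   (@grid_l R (h k) _) (@grid_r R (h k) _).
have N0 k : (0 < 2 * N k)%N by rewrite muln_gt0.
have h0 k : 0 < h k by rewrite divr_gt0// ltr0n.
have te k : (2 * N k)%:R * h k = t by rewrite mulrC divfK// pnatr_eq0 -lt0n.
have mf k : measurable_fun setT (f k) by exact: stepfun_measurable.
have f0 k x : 0 <= f k x.
  by apply: sumr_ge0 => i _; case: ifP => // _; exact: ushape_ge0.
have mitv : measurable (`]0, t[%classic : set R) by exact: measurable_itv.
have If k : (\int[@lebesgue_measure R]_(x in `]0%R, t[) (f k x)%:E <= (2 * t / (1 - p))%:E)%E.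
  apply: (@le_trans _ _ (\int[@lebesgue_measure R]_(x in [set x : R | (0 <= x)%R]) (f k x)%:E)%E).
    apply: ge0_subset_integral => //; first exact: measurable_nneg.
    - by apply/measurable_EFinP; apply: (measurable_funS measurableT _ (mf k)).
    - by move=> x _; rewrite lee_fin.
    - by move=> x /=; rewrite in_itv/= => /andP[/ltW].
  rewrite integral_stepfun_grid//; last by move=> i; exact: ushape_ge0.
  rewrite lee_fin; have := @sum_tag_ushape R (h k) p (N k) (h0 k) isT p01.
  by rewrite te.
have -> : (\int[@lebesgue_measure R]_(x in `]0%R, t[) (ushape t p x)%:E =
   \int[@lebesgue_measure R]_(x in `]0%R, t[) limn_einf (fun k => (f k x)%:E))%E.
  apply: eq_integral => x; rewrite inE/= in_itv/= => xt.
  have cv : (fun k => (f k x)%:E) @ \oo --> (ushape t p x)%:E.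
    apply: cvg_EFin; first by apply: nearW.
    by apply: (@stepfun_tag_cvg R t 1 (ushape t p) x) => //; exact: ushape_continuous.
  by rewrite is_cvg_limn_einfE; [rewrite (cvg_lim _ cv)|apply/cvg_ex; eexists; exact: cv].
apply: le_trans (fatou _ _ _ _) _ => //.
- by move=> k; apply/measurable_EFinP; apply: (measurable_funS measurableT _ (mf k)).
- by move=> k x _; rewrite lee_fin.
rewrite limn_einf_lim; apply: lime_le; first exact: is_cvg_einfs.
apply: nearW => k; apply: le_trans (If k).
by apply: ereal_inf_lbound; exists k => /=.
Qed.

(** * Approximation in L^2 of a function whose square has a U-shaped majorant *)

Section step_approximation.
Context {R : realType} (t p D : R) (q : nat) (f : R -> R).
Context (t0 : 0 < t) (p01 : 0 <= p < 1) (q0 : (0 < q)%N) (D0 : 0 <= D)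
  (f_out : forall x : R, ~~ (0 < x < t) -> f x = 0)
  (f_cont : forall x : R, 0 < x < t -> x != t / 2 -> {for x, continuous f})
  (f_bound : forall x : R, 0 < x < t -> f x ^+ 2 <= D * ushape t p x).

Let N k := (q * k.+1)%N.
Let h k : R := t / (2 * N k)%:R.
Let s k := stepfun (fun i : 'I_(2 * N k) => f (tag (h k) (N k) i))
  (@grid_l R (h k) _) (@grid_r R (h k) _).

Let N_gt0 k : (0 < N k)%N. Proof. by rewrite muln_gt0 q0. Qed.
Let NN_gt0 k : (0 < 2 * N k)%N. Proof. by rewrite muln_gt0 N_gt0. Qed.
Let h_gt0 k : 0 < h k. Proof. by rewrite divr_gt0// ltr0n. Qed.
Let NhE k : (2 * N k)%:R * h k = t.
Proof. by rewrite mulrC divfK// pnatr_eq0 -lt0n. Qed.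

Let s_meas k : measurable_fun setT (s k). Proof. exact: stepfun_measurable. Qed.

(** On (0, t) without t/2 the function is a pointwise limit of step functions; its value at t/2 is
    restored by the indicator of that point. *)
Lemma ushape_majorized_measurable : measurable_fun setT f.
Proof.
pose A := (`]0, t[%classic : set R) `\ (t / 2).
have mA : measurable A by apply: measurableD => //; exact: measurable_itv.
have mfA : measurable_fun A f.
  apply: (@measurable_fun_cvg _ _ _ A s) => //.
    by move=> k; exact: (measurable_funS measurableT _ (s_meas k)).
  move=> x [/=]; rewrite in_itv/= => x0 /eqP x2.
  by apply: stepfun_tag_cvg => //; exact: f_cont.
have -> : f = (f \_ A) \+ (fun x => f (t / 2) * \1_[set t / 2] x).
  apply/funext => x /=; rewrite patchE indicE.
  have [->|xt] := eqVneq x (t / 2).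
    have -> : (t / 2 \in [set t / 2]) = true by exact: mem_set.
    have -> : (t / 2 \in A) = false by apply/negbTE; rewrite notin_setE => -[_]; apply.
    by rewrite mulr1 add0r.
  have -> : (x \in [set t / 2]) = false.
    by apply/memNset => /= xe; rewrite xe eqxx in xt.
  rewrite mulr0 addr0.
  case: ifPn => //; rewrite notin_setE /A /= in_itv/= => xA.
  by apply: f_out; apply/negP => x0; apply: xA; split=> //; exact/eqP.
apply: measurable_funD; last by apply: measurable_funM.
by apply/(measurable_restrictT _ mA).
Qed.

Lemma sum_tag_sqr_le k : (\sum_(i < 2 * N k) f (tag (h k) (N k) i) ^+ 2) * h k <=
  D * (2 * t / (1 - p)).
Proof.
have := @sum_tag_ushape R (h k) p (N k) (h_gt0 k) (N_gt0 k) p01.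
rewrite NhE => /(ler_wpM2l D0); apply: le_trans.
rewrite [leRHS]mulrA ler_pM2r// mulr_sumr; apply: ler_sum => i _; apply: f_bound.
by have := tag_itv i (h_gt0 k); rewrite NhE.
Qed.

(** Dominated convergence: (u - v)^2 <= 2 u^2 + 2 v^2, and both squares are at most D *
    [ushape t p x], the one at the tag because of [tag_min]. This is the bound [g]. *)
Lemma stepfun_tag_L2_cvg : (fun k => (\int[@lebesgue_measure R]_(x in [set x : R | (0 <= x)%R])
    ((s k x - f x) ^+ 2)%:E)%E) @ \oo --> 0%E.
Proof.
have mf := ushape_majorized_measurable.
pose g := (fun x => 4 * D * ushape t p x) \_ (`]0, t[%classic : set R).
have mI : measurable (`]0, t[%classic : set R) by exact: measurable_itv.
have mg : measurable_fun setT g.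
  apply/(measurable_restrictT _ mI); apply: (measurable_funS measurableT) => //.
  by apply: measurable_funM => //; exact: ushape_measurable.
have ig : (@lebesgue_measure R).-integrable [set x : R | 0 <= x] (EFin \o g).
  apply/integrableP; split.
    by apply/measurable_EFinP; exact: (measurable_funS measurableT _ mg).
  have g0 x : 0 <= g x.
    rewrite /g patchE; case: ifP => // _; rewrite !mulr_ge0//.
    exact: ushape_ge0.
  under eq_integral do rewrite /= ger0_norm//.
  apply: (@le_lt_trans _ _ (\int[@lebesgue_measure R]_x (g x)%:E)%E).
    apply: ge0_subset_integral => //; first exact: measurable_nneg.
      exact/measurable_EFinP.
    by move=> x _; rewrite lee_fin.
  have -> : (fun x => (g x)%:E) = (fun x => (4 * D * ushape t p x)%:E) \_ (`]0, t[%classic : set R).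
    by apply/funext => x; rewrite /g !patchE; case: ifP.
  rewrite -integral_mkcond.
  under eq_integral do rewrite EFinM.
  rewrite ge0_integralZl//; last 3 first.
  - apply/measurable_EFinP; apply: (measurable_funS measurableT) => //.
    exact: ushape_measurable.
  - by move=> x _; rewrite lee_fin ushape_ge0.
  - by rewrite lee_fin mulr_ge0.
  apply: (@le_lt_trans _ _ ((4 * D)%:E * (2 * t / (1 - p))%:E)%E); last by rewrite -EFinM ltry.
  by rewrite lee_wpmul2l ?lee_fin ?mulr_ge0// integral_ushape.
(* Besides t/2, the point t is left out: it lies in the last half-open cell, where the step function
   may be nonzero, while f t = 0. *)
have ae_off (P : R -> Prop) : (forall x, ~ ([set t / 2] `|` [set t]) x -> P x) ->
    {ae @lebesgue_measure R, forall x, P x}.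
  move=> hP; exists ([set t / 2] `|` [set t]); split; first exact: measurableU.
    apply/eqP; rewrite eq_le measure_ge0 andbT; apply: le_trans (measureU2 _ _ _) _ => //.
    apply: (@le_trans _ _ (0 + 0)%E); last by rewrite adde0.
    apply: leeD; first by rewrite -(lebesgue_measure_set1 (t / 2)).
    by rewrite -(lebesgue_measure_set1 t).
  by move=> x /= nP; apply: contrapT => xN; exact: nP (hP _ xN).
have DC := @dominated_convergence _ _ _ (@lebesgue_measure R) _ (@measurable_nneg R)
  (fun k x => ((s k x - f x) ^+ 2)%:E) (cst 0%E) (EFin \o g).
have m1 k : measurable_fun [set x : R | 0 <= x] (fun x => ((s k x - f x) ^+ 2)%:E).
  apply/measurable_EFinP; apply: (measurable_funS measurableT) => //.
  by apply: measurable_funX; apply: measurable_funB.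
have a1 : {ae @lebesgue_measure R, forall x, 0 <= x ->
    (fun k => ((s k x - f x) ^+ 2)%:E) @ \oo --> 0%E}.
  apply: ae_off => x xN x0.
  have cs : s ^~ x @ \oo --> f x.
    have [xt|xt] := boolP (0 < x < t).
      apply: stepfun_tag_cvg => //; apply: f_cont => //; apply/eqP => xe.
      by apply: xN; left.
    rewrite f_out// (_ : s ^~ x = cst 0); first exact: cvg_cst.
    apply/funext => k; rewrite /s stepfun_out// NhE; apply: contra xt => /andP[-> xt].
    by rewrite lt_neqAle xt andbT/=; apply/eqP => xe; apply: xN; right.
  apply: cvg_EFin; first by apply: nearW.
  rewrite [X in _ --> X](_ : _ = (f x - f x) * (f x - f x)); last by rewrite subrr mul0r.
  have cd : (fun k => s k x - f x) @ \oo --> f x - f x by apply: cvgB => //; exact: cvg_cst.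
  exact: (cvgM cd cd).
have a2 : {ae @lebesgue_measure R, forall x, forall k, 0 <= x ->
    (`|((s k x - f x) ^+ 2)%:E| <= (g x)%:E)%E}.
  apply: ae_off => x xN k x0 /=.
  rewrite lee_fin ger0_norm ?sqr_ge0// /g patchE.
  have [xt|xt] := boolP (0 < x < t); last first.
    rewrite memNset; last by rewrite /= in_itv/=; exact/negP.
    rewrite f_out// /s stepfun_out ?subrr ?expr0n//= NhE; apply: contra xt => /andP[-> xt].
    by rewrite lt_neqAle xt andbT/=; apply/eqP => xe; apply: xN; right.
  rewrite mem_set; last by rewrite /= in_itv/=.
  have [|i hi] := @cell_exists R (h k) (2 * N k) x (h_gt0 k).
    by rewrite NhE; case/andP: xt => -> /ltW.
  rewrite /s (stepfun_cell _ (h_gt0 k) hi).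
  have h1 := f_bound xt.
  have h2 : f (tag (h k) (N k) i) ^+ 2 <= D * ushape t p x.
    apply: le_trans (f_bound _) _; first by have := tag_itv i (h_gt0 k); rewrite NhE.
    rewrite ler_wpM2l//; have := tag_min (h_gt0 k) hi; rewrite NhE => hm.
    case/andP: p01 => p0 _; case/andP: xt => x0' xt.
    apply: le_powRN => //; first by rewrite divr_gt0// lt_min x0'/=; lra.
    by rewrite ler_pM2r// invr_gt0.
  move: h1 h2; set u := f (tag _ _ _); set v := f x; set U := ushape t p x => h1 h2.
  have : 0 <= (u + v) ^+ 2 by exact: sqr_ge0.
  rewrite sqrrD sqrrB -!mulrA; lra.
have [_ _] := DC m1 (@measurable_cst _ _ _ _ _ _) a1 ig a2.
by rewrite integral0.
Qed.

End step_approximation.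

(** * Characteristic functions of sums of independent variables *)

Definition bounded_mfun d (T : measurableType d) (R : realType) (f : T -> R) : Prop :=
  measurable_fun setT f /\ exists K : R, forall w, `|f w| <= K.

Section bounded_mfun.
Context d (T : measurableType d) (R : realType) (P : probability T R).
Implicit Types f g : T -> R.

Lemma bounded_mfun_integrable f : bounded_mfun f -> P.-integrable setT (EFin \o f).
Proof.
move=> [mf [K hK]]; apply: measurable_bounded_integrable => //.
  by apply: (@le_lt_trans _ _ 1%E); [exact: probability_le1|exact: ltry].
by exists K; split; [exact: num_real|move=> x Kx w _; apply: le_trans (ltW Kx)].
Qed.

Lemma bounded_mfun_cst (c : R) : bounded_mfun (fun _ : T => c).
Proof. by split=> //; exists `|c|. Qed.

Lemma bounded_mfunD f g : bounded_mfun f -> bounded_mfun g ->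
  bounded_mfun (fun w => f w + g w).
Proof.
move=> [mf [K hK]] [mg [K' hK']]; split; first exact: measurable_funD.
by exists (K + K') => w; apply: le_trans (ler_normD _ _) _; exact: lerD.
Qed.

Lemma bounded_mfunM f g : bounded_mfun f -> bounded_mfun g ->
  bounded_mfun (fun w => f w * g w).
Proof.
move=> [mf [K hK]] [mg [K' hK']]; split; first exact: measurable_funM.
by exists (K * K') => w; rewrite normrM; exact: ler_pM.
Qed.

Lemma bounded_mfunB f g : bounded_mfun f -> bounded_mfun g ->
  bounded_mfun (fun w => f w - g w).
Proof.
move=> bf bg; have := bounded_mfunD bf (bounded_mfunM (bounded_mfun_cst (-1)) bg).
by congr bounded_mfun; apply/funext => w; rewrite mulN1r.
Qed.

Lemma bounded_mfun_sum (n : nat) (f : 'I_n -> T -> R) :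
  (forall i, bounded_mfun (f i)) -> bounded_mfun (fun w => \sum_(i < n) f i w).
Proof.
elim: n f => [|n ih] f bf.
  by under eq_fun do rewrite big_ord0; exact: bounded_mfun_cst.
under eq_fun do rewrite big_ord_recr/=.
by apply: bounded_mfunD => //; exact: ih.
Qed.

Lemma bounded_mfun_prod (n : nat) (f : nat -> T -> R) (Q : pred nat) :
  (forall i, bounded_mfun (f i)) -> bounded_mfun (fun w => \prod_(i < n | Q i) f i w).
Proof.
elim: n => [|n ih] bf.
  by under eq_fun do rewrite big_ord0; exact: bounded_mfun_cst.
under eq_fun do rewrite big_mkcond big_ord_recr/= -big_mkcond.
apply: bounded_mfunM; first exact: ih.
by case: (Q n) => //; exact: bounded_mfun_cst.
Qed.

Lemma bounded_mfun_indic (X : T -> R) (B : set R) : measurable_fun setT X ->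
  measurable B -> bounded_mfun (fun w => \1_B (X w) : R).
Proof.
move=> mX mB; split.
  by apply: (measurableT_comp _ mX); exact: measurable_indic.
by exists 1 => w; rewrite indicE; case: (_ \in _); rewrite ?normr1 ?normr0.
Qed.

Lemma RintegralD_bounded f g : bounded_mfun f -> bounded_mfun g ->
  \int[P]_w (f w + g w) = \int[P]_w f w + \int[P]_w g w.
Proof. by move=> bf bg; rewrite RintegralD//; exact: bounded_mfun_integrable. Qed.

Lemma RintegralZ_bounded (c : R) f : bounded_mfun f ->
  \int[P]_w (c * f w) = c * \int[P]_w f w.
Proof. by move=> bf; rewrite RintegralZl//; exact: bounded_mfun_integrable. Qed.

Lemma RintegralB_bounded f g : bounded_mfun f -> bounded_mfun g ->
  \int[P]_w (f w - g w) = \int[P]_w f w - \int[P]_w g w.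
Proof. by move=> bf bg; rewrite RintegralB//; exact: bounded_mfun_integrable. Qed.

Lemma Rintegral_sum_bounded (n : nat) (f : 'I_n -> T -> R) :
  (forall i, bounded_mfun (f i)) ->
  \int[P]_w (\sum_(i < n) f i w) = \sum_(i < n) \int[P]_w f i w.
Proof.
elim: n f => [|n ih] f bf.
  rewrite big_ord0; under eq_Rintegral do rewrite big_ord0.
  by rewrite Rintegral_cst// mul0r.
rewrite big_ord_recr/= -ih//; under eq_Rintegral do rewrite big_ord_recr/=.
by rewrite RintegralD_bounded//; exact: bounded_mfun_sum.
Qed.

Lemma Rintegral_prob_cst (c : R) : \int[P]_w (c : R) = c.
Proof. rewrite Rintegral_cst// -[RHS]mulr1; congr (_ * _).
exact: (congr1 fine (probability_setT P)). Qed.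

Lemma le_Rintegral_bounded f g : bounded_mfun f -> bounded_mfun g ->
  (forall w, f w <= g w) -> \int[P]_w f w <= \int[P]_w g w.
Proof. by move=> bf bg fg; apply: le_Rintegral => //; exact: bounded_mfun_integrable. Qed.

Lemma norm_Rintegral_bounded f (K : R) : measurable_fun setT f ->
  (forall w, `|f w| <= K) -> `|\int[P]_w f w| <= K.
Proof.
move=> mf hK; have bf : bounded_mfun f by split=> //; exists K.
rewrite ler_norml -[X in X <= _](Rintegral_prob_cst (- K)) -[X in _ && (_ <= X)](Rintegral_prob_cst K).
by apply/andP; split; apply: le_Rintegral_bounded => //; try exact: bounded_mfun_cst;
  move=> w; have := hK w; rewrite ler_norml => /andP[].
Qed.

Lemma Rintegral_indic_comp (X : T -> R) (B : set R) : measurable_fun setT X ->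
  measurable B -> \int[P]_w (\1_B (X w) : R) = fine (P [set w | B (X w)]).
Proof.
move=> mX mB; rewrite /Rintegral; congr fine.
have mA : measurable [set w | B (X w)] by rewrite -[X in measurable X]setTI; exact: mX.
rewrite -[X in P X]setIT -integral_indic//.
Qed.

(* Uniform approximation of [g] by functions with finitely many values. *)
Lemma Rintegral_mul_comp (W X : T -> R) (g : R -> R) (c : R) :
  bounded_mfun W -> measurable_fun setT X -> measurable_fun setT g ->
  (forall y, `|g y| <= 1) ->
  (forall B : set R, measurable B ->
     \int[P]_w (W w * (\1_B (X w) : R)) = c * \int[P]_w (\1_B (X w) : R)) ->
  \int[P]_w (W w * g (X w)) = c * \int[P]_w g (X w).
Proof.
move=> bW mX mg g1 hB; have [mW [K hK]] := bW.
have bg : bounded_mfun (fun w => g (X w)).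
  by split; [exact: (measurableT_comp mg mX)|exists 1].
(* The shift puts the values into [1, 3], inside (0, 4], which the half-open cells of mesh 4/n
   cover. It is harmless, because B = [setT] shows that W has integral c. *)
pose G w := g (X w) + 2.
have bG : bounded_mfun G by apply: bounded_mfunD => //; exact: bounded_mfun_cst.
have bI B : measurable B -> bounded_mfun (fun w => \1_B (X w) : R) by exact: bounded_mfun_indic.
suff hG : \int[P]_w (W w * G w) = c * \int[P]_w G w.
  have h2 : \int[P]_w W w = c.
    have := hB setT measurableT; under eq_Rintegral do rewrite indicT mulr1.
    move=> ->; under eq_Rintegral do rewrite indicT.
    by rewrite Rintegral_prob_cst mulr1.
  move: hG; rewrite /G RintegralD_bounded//; last exact: bounded_mfun_cst.
  under eq_Rintegral do rewrite mulrDr.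
  have bW2 : bounded_mfun (fun w => W w * 2).
    by apply: bounded_mfunM => //; exact: bounded_mfun_cst.
  rewrite RintegralD_bounded//; last exact: bounded_mfunM.
  rewrite [X in _ + X = _](_ : _ = c * 2).
    by rewrite Rintegral_prob_cst; lra.
  under eq_Rintegral do rewrite mulrC.
  by rewrite RintegralZ_bounded// h2 mulrC.
apply/eqP; rewrite -subr_eq0 -normr_le0; apply/ler_addgt0Pl => e e0; rewrite addr0.
(* Replacing [G] by [s] changes the two sides by at most |K| h and |c| h. *)
pose M := `|K| + `|c| + 1.
have M0 : 0 < M by rewrite /M ltr_pwDr// addr_ge0.
pose n := (Num.truncn (4 * M / e)).+1.
have hn : 4 * M / e < n%:R.
  have := @truncn_itv R (4 * M / e); rewrite divr_ge0 ?mulr_ge0 ?(ltW M0) ?(ltW e0)//.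
  by move=> /(_ isT)/andP[].
have n0 : 0 < n%:R :> R by rewrite ltr0n.
pose h : R := 4 / n%:R.
have h0 : 0 < h by rewrite divr_gt0.
have nh : n%:R * h = 4 by rewrite mulrC divfK// gt_eqF.
have Mh : M * h <= e.
  by rewrite /h mulrA ler_pdivrMr// [M * 4]mulrC [leRHS]mulrC -ler_pdivrMr// ltW.
pose s w := stepfun (fun i : 'I_n => i%:R * h) (@grid_l R h n) (@grid_r R h n) (G w).
have sG w : `|s w - G w| <= h.
  have [|i hi] := @cell_exists R h n (G w) h0.
    by rewrite nh /G; have := g1 (X w); rewrite ler_norml => /andP[]; lra.
  rewrite /s (stepfun_cell _ h0 hi) ler_norml; case/andP: hi.
  by rewrite -natr1 mulrDl mul1r; lra.
have bs : bounded_mfun s.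
  split; first by case: bG => mG _; exact: (measurableT_comp (stepfun_measurable _ _ _) mG).
  case: bG => _ [KG hKG]; exists (h + KG) => w.
  by rewrite -[s w](subrK (G w)); apply: le_trans (ler_normD _ _) _; exact: lerD.
pose B (i : 'I_n) : set R := (fun y => g y + 2) @^-1` `]@grid_l R h n i, @grid_r R h n i]%classic.
have mB i : measurable (B i).
  have mg2 : measurable_fun setT (fun y => g y + 2) by apply: measurable_funD.
  by rewrite /B -[X in measurable X]setTI; apply: mg2 => //; exact: measurable_itv.
have sE w : s w = \sum_(i < n) (i%:R * h) * (\1_(B i) (X w) : R).
  apply: eq_bigr => i _; rewrite indicE.
  have -> : (X w \in B i) = (grid_l h i < G w <= grid_r h i).
    by apply/idP/idP => [/set_mem|hh]; [|apply/mem_set]; rewrite /B/= in_itv.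
  by case: ifP => _; rewrite ?mulr1 ?mulr0.
have hs : \int[P]_w (W w * s w) = c * \int[P]_w s w.
  under [X in _ * X]eq_Rintegral do rewrite sE.
  under eq_Rintegral do rewrite sE mulr_sumr.
  rewrite !Rintegral_sum_bounded; last 2 first.
  - by move=> i; apply: bounded_mfunM; [exact: bounded_mfun_cst|exact: bI].
  - move=> i; apply: bounded_mfunM => //.
    by apply: bounded_mfunM; [exact: bounded_mfun_cst|exact: bI].
  rewrite mulr_sumr; apply: eq_bigr => i _.
  under eq_Rintegral do rewrite mulrCA.
  rewrite (@RintegralZ_bounded _ (fun w => W w * (\1_(B i) (X w) : R))); last first.
    by apply: bounded_mfunM => //; exact: bI.
  rewrite (@RintegralZ_bounded _ (fun w => \1_(B i) (X w) : R)); last exact: bI.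
  by rewrite hB// mulrCA.
have -> : \int[P]_w (W w * G w) - c * \int[P]_w G w =
    c * \int[P]_w (s w - G w) - \int[P]_w (W w * (s w - G w)).
  under [X in _ = _ - X]eq_Rintegral do rewrite mulrBr.
  rewrite !RintegralB_bounded//; try exact: bounded_mfunM.
  by rewrite hs; ring.
apply: le_trans Mh; apply: le_trans (ler_normB _ _) _.
have bsG := bounded_mfunB bs bG.
rewrite normrM /M !mulrDl mul1r.
have h1 : `|\int[P]_w (s w - G w)| <= h by apply: norm_Rintegral_bounded => //; case: bsG.
have h2 : `|\int[P]_w (W w * (s w - G w))| <= `|K| * h.
  apply: norm_Rintegral_bounded; first by have [] := bounded_mfunM bW bsG.
  by move=> w; rewrite normrM; apply: ler_pM => //; apply: le_trans (hK w) (ler_norm _).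
have := ler_wpM2l (normr_ge0 c) h1; lra.
Qed.

Definition char_sqr (X : T -> R) (u : R) : R :=
  (\int[P]_w cos (u * X w)) ^+ 2 + (\int[P]_w sin (u * X w)) ^+ 2.

Lemma cos_comp_bounded (X : T -> R) : measurable_fun setT X ->
  bounded_mfun (fun w => cos (X w)).
Proof.
move=> mX; split; last by exists 1 => w; exact: cos_max.
apply: (measurableT_comp _ mX); apply: continuous_measurable_fun => x.
exact: continuous_cos.
Qed.

Lemma sin_comp_bounded (X : T -> R) : measurable_fun setT X ->
  bounded_mfun (fun w => sin (X w)).
Proof.
move=> mX; split; last by exists 1 => w; exact: sin_max.
apply: (measurableT_comp _ mX); apply: continuous_measurable_fun => x.
exact: continuous_sin.
Qed.

Lemma measurable_cosM (u : R) : measurable_fun setT (fun y : R => cos (u * y)).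
Proof.
apply: continuous_measurable_fun => x; apply: continuous_comp.
  exact: mulrl_continuous.
exact: continuous_cos.
Qed.

Lemma measurable_sinM (u : R) : measurable_fun setT (fun y : R => sin (u * y)).
Proof.
apply: continuous_measurable_fun => x; apply: continuous_comp.
  exact: mulrl_continuous.
exact: continuous_sin.
Qed.

(** Real and imaginary parts of the product of the complex numbers c_k + i s_k over k < j. *)
Fixpoint polar_prod (c s : nat -> R) (j : nat) : R * R :=
  if j is j'.+1 then
    let CS := polar_prod c s j' in
    (CS.1 * c j' - CS.2 * s j', CS.2 * c j' + CS.1 * s j')
  else (1, 0).

Lemma polar_prod_norm c s n :
  (polar_prod c s n).1 ^+ 2 + (polar_prod c s n).2 ^+ 2 =
  \prod_(i < n) (c i ^+ 2 + s i ^+ 2).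
Proof.
elim: n => [|n ih]; first by rewrite big_ord0 /= expr1n expr0n addr0.
by rewrite big_ord_recr/= -ih; ring.
Qed.

(** * Multiplicativity of the characteristic function under independence *)

Section independence.
Context (n : nat) (X : nat -> T -> R) (mX : forall i, measurable_fun setT (X i))
  (indX : forall B : nat -> set R, (forall i, measurable (B i)) ->
    P [set w | forall i : 'I_n, B i (X i w)] = (\prod_(i < n) P [set w | B i (X i w)])%E).

Let I (B : nat -> set R) (i : nat) (w : T) : R := \1_(B i) (X i w).

Let bI B i : (forall i, measurable (B i)) -> bounded_mfun (I B i).
Proof. by move=> mB; apply: bounded_mfun_indic. Qed.

Let prod_tail (F : nat -> R) (j : nat) (jn : (j < n)%N) :
  \prod_(i < n | (j <= i)%N) F i = F j * \prod_(i < n | (j < i)%N) F i.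
Proof.
rewrite (bigD1 (Ordinal jn))//=; congr (_ * _); apply: eq_bigl => i.
by rewrite -val_eqE/= ltn_neqAle eq_sym andbC.
Qed.

Lemma independent_indic (B : nat -> set R) : (forall i, measurable (B i)) ->
  \int[P]_w (\prod_(i < n) I B i w) = \prod_(i < n) \int[P]_w I B i w.
Proof.
move=> mB.
have mE i : measurable [set w | B i (X i w)].
  by rewrite -[X in measurable X]setTI; exact: mX.
have e w : \prod_(i < n) I B i w = \1_[set w | forall i : 'I_n, B i (X i w)] w.
  rewrite indicE; have [|] := pselect (forall i : 'I_n, B i (X i w)) => h.
    by rewrite mem_set// big1// => i _; rewrite /I indicE mem_set.
  rewrite memNset//; have [i hi] : exists i : 'I_n, ~ B i (X i w) by exact/existsNP.
  by rewrite (bigD1 i)//= /I indicE memNset// mul0r.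
under eq_Rintegral do rewrite e.
have mEE : measurable [set w | forall i : 'I_n, B i (X i w)].
  rewrite (_ : [set _ | _] = \big[setI/setT]_(i < n) [set w | B i (X i w)]).
    exact: bigsetI_measurable.
  rewrite -(bigcap_mkord n (fun i => [set w | B i (X i w)])).
  by apply/seteqP; split => w /= h i; [move=> /= ilt; exact: (h (Ordinal ilt))|exact: (h i (ltn_ord i))].
rewrite /Rintegral integral_indic// setIT; apply: (etrans (congr1 fine (indX mB))).
have fE i : P [set w | B i (X i w)] = (\int[P]_w I B i w)%:E.
  by rewrite Rintegral_indic_comp// fineK// fin_num_measure.
under eq_bigr do rewrite fE.
by rewrite -(big_morph EFin EFinM (erefl _)).
Qed.

Let S (a : nat -> R) (j : nat) (w : T) : R := \sum_(i < j) a i * X i w.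

Let mS a j : measurable_fun setT (S a j).
Proof. by apply: measurable_sum => i; exact: measurable_funM. Qed.

Let c (a : nat -> R) (i : nat) : R := \int[P]_w cos (a i * X i w).
Let s (a : nat -> R) (i : nat) : R := \int[P]_w sin (a i * X i w).

(* The factors are replaced one at a time: the first [j] of them have become
   trigonometric functions, the others are still indicator functions. *)
Lemma independent_trig_indic (a : nat -> R) (j : nat) : (j <= n)%N ->
  forall B : nat -> set R, (forall i, measurable (B i)) ->
  \int[P]_w (cos (S a j w) * \prod_(i < n | (j <= i)%N) I B i w) =
    (polar_prod (c a) (s a) j).1 * \prod_(i < n | (j <= i)%N) \int[P]_w I B i w /\
  \int[P]_w (sin (S a j w) * \prod_(i < n | (j <= i)%N) I B i w) =
    (polar_prod (c a) (s a) j).2 * \prod_(i < n | (j <= i)%N) \int[P]_w I B i w.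
Proof.
elim: j => [_|j ih jn] B mB.
  have S0 w : S a 0 w = 0 by rewrite /S big_ord0.
  split.
    under eq_Rintegral do rewrite S0 cos0 mul1r.
    by rewrite /= mul1r; exact: independent_indic.
  under eq_Rintegral do rewrite S0 sin0 mul0r.
  by rewrite Rintegral_prob_cst /= mul0r.
pose Pr w := \prod_(i < n | (j < i)%N) I B i w.
pose p := \prod_(i < n | (j < i)%N) \int[P]_w I B i w.
have bPr : bounded_mfun Pr.
  by apply: (@bounded_mfun_prod n (I B) (fun i => j < i)%N) => i; exact: bI.
have bC := cos_comp_bounded (mS a j); have bS := sin_comp_bounded (mS a j).
have ih' (D : set R) : measurable D ->
    \int[P]_w (cos (S a j w) * Pr w * (\1_D (X j w) : R)) =
      (polar_prod (c a) (s a) j).1 * p * \int[P]_w (\1_D (X j w) : R) /\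
    \int[P]_w (sin (S a j w) * Pr w * (\1_D (X j w) : R)) =
      (polar_prod (c a) (s a) j).2 * p * \int[P]_w (\1_D (X j w) : R).
  (* An arbitrary set [D] in place j turns the induction hypothesis into the premise of
     [Rintegral_mul_comp], which then admits cos and sin of the j-th variable. *)
  move=> mD; pose B' i := if i == j then D else B i.
  have mB' i : measurable (B' i) by rewrite /B'; case: ifP.
  have e1 w : \prod_(i < n | (j <= i)%N) I B' i w = Pr w * (\1_D (X j w) : R).
    rewrite (prod_tail (fun i => I B' i w) jn) mulrC /I /B' eqxx; congr (_ * _).
    by apply: eq_bigr => i ji; rewrite gtn_eqF.
  have e2 : \prod_(i < n | (j <= i)%N) \int[P]_w I B' i w =
      p * \int[P]_w (\1_D (X j w) : R).
    rewrite (prod_tail (fun i => \int[P]_w I B' i w) jn) mulrC /I /B' eqxx; congr (_ * _).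
    by apply: eq_bigr => i ji; rewrite gtn_eqF.
  have [h1 h2] := ih (ltnW jn) B' mB'; rewrite -!mulrA -e2 -h1 -h2.
  by split; apply: eq_Rintegral => w _; rewrite e1 mulrA.
have mcos := measurable_cosM (a j); have msin := measurable_sinM (a j).
have bCP := bounded_mfunM bC bPr; have bSP := bounded_mfunM bS bPr.
have bc : bounded_mfun (fun w => cos (a j * X j w)).
  by apply: cos_comp_bounded; exact: measurable_funM.
have bs : bounded_mfun (fun w => sin (a j * X j w)).
  by apply: sin_comp_bounded; exact: measurable_funM.
have cc := Rintegral_mul_comp bCP (mX j) mcos (fun y => cos_max _) (fun D mD => (ih' D mD).1).
have cs := Rintegral_mul_comp bCP (mX j) msin (fun y => sin_max _) (fun D mD => (ih' D mD).1).
have sc := Rintegral_mul_comp bSP (mX j) mcos (fun y => cos_max _) (fun D mD => (ih' D mD).2).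
have ss := Rintegral_mul_comp bSP (mX j) msin (fun y => sin_max _) (fun D mD => (ih' D mD).2).
have SS w : S a j.+1 w = S a j w + a j * X j w by rewrite /S big_ord_recr.
split.
  under eq_Rintegral => w _.
    rewrite SS cosD mulrBl -/(Pr w) [X in X - _]mulrAC [X in _ - X]mulrAC; over.
  rewrite RintegralB_bounded ?cc ?ss -/p /= -/(c a j) -/(s a j); [by ring| |];
    exact: bounded_mfunM.
under eq_Rintegral => w _.
  rewrite SS sinD mulrDl -/(Pr w) [X in X + _]mulrAC [X in _ + X]mulrAC; over.
rewrite RintegralD_bounded ?cs ?sc -/p /= -/(c a j) -/(s a j); [by ring| |];
  exact: bounded_mfunM.
Qed.

Lemma char_sqr_independent_sum (a : nat -> R) (u : R) :
  char_sqr (fun w => \sum_(i < n) a i * X i w) u =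
  \prod_(i < n) char_sqr (X i) (u * a i).
Proof.
have [h1 h2] := @independent_trig_indic (fun i => u * a i) n (leqnn n) (fun=> setT) (fun=> measurableT).
have e0 (F : nat -> R) : \prod_(i < n | (n <= i)%N) F i = 1.
  by rewrite big1// => i; rewrite leqNgt ltn_ord.
have SE w : S (fun i => u * a i) n w = u * \sum_(i < n) a i * X i w.
  by rewrite mulr_sumr; apply: eq_bigr => i _; rewrite mulrA.
rewrite /char_sqr -(polar_prod_norm (c (fun i => u * a i)) (s (fun i => u * a i)) n).
congr (_ ^+ 2 + _ ^+ 2).
  move: h1; rewrite (e0 (fun i => \int[P]_w I _ i w)) mulr1 => <-.
  by apply: eq_Rintegral => w _; rewrite (e0 (fun i => I _ i w)) mulr1 SE.
move: h2; rewrite (e0 (fun i => \int[P]_w I _ i w)) mulr1 => <-.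
by apply: eq_Rintegral => w _; rewrite (e0 (fun i => I _ i w)) mulr1 SE.
Qed.

End independence.

Lemma Rintegral_eq_dist (X Y : T -> R) (g : R -> R) :
  measurable_fun setT X -> measurable_fun setT Y -> measurable_fun setT g ->
  (forall y, `|g y| <= 1) ->
  (forall B : set R, measurable B -> P [set w | B (X w)] = P [set w | B (Y w)]) ->
  \int[P]_w g (X w) = \int[P]_w g (Y w).
Proof.
move=> mX mY mg g1 hB.
have mg' : measurable_fun setT (EFin \o g) by exact/measurable_EFinP.
have iX : P.-integrable (X @^-1` setT) ((EFin \o g) \o X).
  rewrite preimage_setT; apply: bounded_mfun_integrable.
  by split; [exact: (measurableT_comp mg mX)|exists 1 => w; exact: g1].
have iY : P.-integrable (Y @^-1` setT) ((EFin \o g) \o Y).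
  rewrite preimage_setT; apply: bounded_mfun_integrable.
  by split; [exact: (measurableT_comp mg mY)|exists 1 => w; exact: g1].
have hX := integral_pushforward mX mg' iX measurableT.
have hY := integral_pushforward mY mg' iY measurableT.
rewrite preimage_setT in hX; rewrite preimage_setT in hY.
rewrite /Rintegral -[X in fine X = _]hX -[X in _ = fine X]hY; congr fine.
by apply: eq_measure_integral => A mA _; exact: hB.
Qed.

Lemma char_sqr_eq_dist (X Y : T -> R) (u : R) :
  measurable_fun setT X -> measurable_fun setT Y ->
  (forall B : set R, measurable B -> P [set w | B (X w)] = P [set w | B (Y w)]) ->
  char_sqr X u = char_sqr Y u.
Proof.
move=> mX mY hB; rewrite /char_sqr.
rewrite (Rintegral_eq_dist mX mY (measurable_cosM u) (fun y => cos_max _) hB).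
by rewrite (Rintegral_eq_dist mX mY (measurable_sinM u) (fun y => sin_max _) hB).
Qed.

End bounded_mfun.

(** * Trigonometric inequalities and limits in mean square *)

Lemma norm_sub_cos_le (R : realType) (x y : R) : `|cos x - cos y| <= `|x - y|.
Proof.
wlog xy : x y / y <= x.
  by move=> H; have [/H//|/ltW/H] := leP y x; rewrite distrC [leRHS]distrC.
have [|c _ ->] := @MVT_segment R cos (fun z => - sin z) y x xy (fun z _ => is_derive_cos z).
  by apply: continuous_subspaceT => z; exact: continuous_cos.
by rewrite normrM normrN -[leRHS]mul1r ler_wpM2r// sin_max.
Qed.

Lemma norm_sub_sin_le (R : realType) (x y : R) : `|sin x - sin y| <= `|x - y|.
Proof.
wlog xy : x y / y <= x.
  by move=> H; have [/H//|/ltW/H] := leP y x; rewrite distrC [leRHS]distrC.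
have [|c _ ->] := @MVT_segment R sin cos y x xy (fun z _ => is_derive_sin z).
  by apply: continuous_subspaceT => z; exact: continuous_sin.
by rewrite normrM -[leRHS]mul1r ler_wpM2r// cos_max.
Qed.

Lemma norm_sin_le (R : realType) (x : R) : `|sin x| <= `|x|.
Proof. by have := norm_sub_sin_le x 0; rewrite sin0 !subr0. Qed.

Lemma onem_cosE (R : realType) (x : R) : 1 - cos x = 2 * sin (x / 2) ^+ 2.
Proof.
have -> : cos x = cos ((x / 2) *+ 2) by congr cos; rewrite -mulr_natr; field.
by rewrite cos_mulr2n -[cos (x / 2) ^+ 2]subr0 sin2cos2 -mulr_natr; ring.
Qed.

Lemma onem_cos_ge0 (R : realType) (x : R) : 0 <= 1 - cos x.
Proof. by rewrite subr_ge0 cos_le1. Qed.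

Lemma onem_cos_le (R : realType) (x : R) : 1 - cos x <= x ^+ 2 / 2.
Proof.
rewrite onem_cosE.
have : `|sin (x / 2)| ^+ 2 <= `|x / 2| ^+ 2 by rewrite lerXn2r ?nnegrE// norm_sin_le.
rewrite !real_normK ?num_real// exprMn; lra.
Qed.

Lemma onem_cos_double (R : realType) (x : R) : 1 - cos (2 * x) <= 4 * (1 - cos x).
Proof.
rewrite mulr_natl cos_mulr2n -mulr_natr; have := sqr_ge0 (cos x - 1); nra.
Qed.

(** Mean value theorem, with |cos c - 1| <= |c| for the derivative. The order 2 is what a finite
    second moment can integrate. *)
Lemma norm_sin_sub_id_le (R : realType) (x : R) : `|sin x - x| <= x ^+ 2.
Proof.
wlog x0 : x / 0 <= x.
  move=> H; have [/H//|/ltW] := leP 0 x; rewrite -oppr_ge0 => /H.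
  by rewrite sinN sqrrN -opprD normrN.
have hd (z : R) : z \in `]0, x[ -> is_derive z 1 (fun z => sin z - z) (cos z - 1).
  by move=> _; apply: is_deriveB.
have hc : {within `[0, x], continuous (fun z : R => sin z - z)}.
  apply: continuous_subspaceT => z; apply: continuousB; [exact: continuous_sin|exact: cvg_id].
have [c cx] := MVT_segment x0 hd hc.
rewrite sin0 !subr0 => ->; rewrite normrM (ger0_norm x0) expr2 ler_wpM2r//.
move: cx; rewrite in_itv/= => /andP[c0 cx].
have := norm_sub_cos_le c 0; rewrite cos0 subr0 (ger0_norm c0) => h.
exact: le_trans cx.
Qed.

(** Here |sin(x/2)| >= |x|/2 - x^2/4 >= |x|/4, and 1 - cos x = 2 sin(x/2)^2. *)
Lemma onem_cos_ge (R : realType) (x : R) : `|x| <= 1 -> x ^+ 2 / 8 <= 1 - cos x.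
Proof.
move=> x1; rewrite onem_cosE.
have h := norm_sin_sub_id_le (x / 2).
have h2 : `|x / 2| - `|sin (x / 2)| <= (x / 2) ^+ 2.
  by apply: le_trans h; rewrite distrC; exact: lerB_dist.
have h3 : (x / 2) ^+ 2 = `|x / 2| ^+ 2 by rewrite real_normK// num_real.
have h4 : `|x / 2| = `|x| / 2 by rewrite normrM normfV normr_nat.
have h5 : sin (x / 2) ^+ 2 = `|sin (x / 2)| ^+ 2 by rewrite real_normK// num_real.
have h6 : x ^+ 2 = `|x| ^+ 2 by rewrite real_normK// num_real.
rewrite h3 h4 in h2; rewrite h5 h6.
have n0 := normr_ge0 x; set y := `|x| in x1 n0 h2 *; set z := `|sin _| in h2 *.
have z1 : y / 4 <= z by nra.
have : (y / 4) ^+ 2 <= z ^+ 2 by rewrite lerXn2r ?nnegrE//; lra.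
rewrite exprMn; lra.
Qed.

Section char_sqr_limit.
Context d (T : measurableType d) (R : realType) (P : probability T R).

(** Integrates y <= de + y^2 / de; with de of the order of the square root of m it does the work of
    the Cauchy-Schwarz inequality. *)
Lemma integral_sqr_bound (f D : T -> R) (de m : R) :
  bounded_mfun f -> measurable_fun setT D -> 0 < de ->
  (forall w, `|f w| <= `|D w|) ->
  (\int[P]_w (D w ^+ 2)%:E < m%:E)%E ->
  `|\int[P]_w f w| <= de + m / de.
Proof.
move=> bf mD de0 fD hm; have [mf _] := bf.
have iF := bounded_mfun_integrable P bf.
apply: le_trans (le_normr_Rintegral _ _) _ => //.
have key : (\int[P]_w `|f w|%:E <= (de + m / de)%:E)%E.
  apply: (@le_trans _ _ (\int[P]_w (de%:E + de^-1%:E * (D w ^+ 2)%:E))%E).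
    apply: ge0_le_integral => //.
    - by apply/measurable_EFinP; exact: measurableT_comp.
    - apply: emeasurable_funD => //; apply: emeasurable_funM => //.
      by apply/measurable_EFinP; exact: measurable_funX.
    - move=> w _; rewrite -EFinM -EFinD lee_fin; apply: le_trans (fD w) _.
      rewrite -[D w ^+ 2]real_normK ?num_real//.
      set x := `|D w|; have x0 : 0 <= x by rewrite /x.
      rewrite -(@ler_pM2r _ de)// mulrDl mulrAC mulVf ?gt_eqF// mul1r.
      by have := sqr_ge0 (x - de); nra.
  rewrite ge0_integralD//; last 3 first.
  - by move=> w _; rewrite lee_fin ltW.
  - by move=> w _; rewrite -EFinM lee_fin mulr_ge0 ?sqr_ge0// invr_ge0 ltW.
  - apply: emeasurable_funM => //.
    by apply/measurable_EFinP; exact: measurable_funX.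
  rewrite integral_cst// [X in (_ * X + _)%E](probability_setT P) mule1.
  rewrite ge0_integralZl//; last 3 first.
  - by apply/measurable_EFinP; exact: measurable_funX.
  - by move=> w _; rewrite lee_fin sqr_ge0.
  - by rewrite lee_fin invr_ge0 ltW.
  rewrite EFinD leeD2l// mulrC EFinM; apply: lee_wpmul2l; last exact: ltW.
  by rewrite lee_fin invr_ge0 ltW.
rewrite /Rintegral -lee_fin fineK//.
apply: integrable_fin_num => //.
exact: integrable_norm.
Qed.

Lemma Rintegral_trig_L2_cvg (S : nat -> T -> R) (Y : T -> R) (g : R -> R) (K : R) :
  (forall k, measurable_fun setT (S k)) -> measurable_fun setT Y ->
  measurable_fun setT g -> (forall y, `|g y| <= 1) ->
  (forall x y, `|g x - g y| <= K * `|x - y|) ->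
  (fun k => (\int[P]_w ((S k w - Y w) ^+ 2)%:E)%E) @ \oo --> 0%E ->
  (fun k => \int[P]_w g (S k w)) @ \oo --> \int[P]_w g (Y w).
Proof.
move=> mS mY mg g1 gK cv.
have b (Z : T -> R) : measurable_fun setT Z -> bounded_mfun (fun w => g (Z w)).
  by move=> mZ; split; [exact: (measurableT_comp mg mZ)|exists 1].
apply/cvgrPdist_le => e e0.
pose L := `|K| + 1.
have L0 : 0 < L by rewrite /L ltr_pwDr.
(* Chosen so that L^2 m = (e/2)^2: with de = e/2 both terms of [integral_sqr_bound] equal e/2. *)
pose m := (e / 2) ^+ 2 / L ^+ 2.
have m0 : 0 < m by rewrite divr_gt0// exprn_gt0// divr_gt0.
have [hfin /cvgrPdist_lt/(_ m m0) hm] := (fine_cvgP _ _).1 cv.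
near=> k.
rewrite -RintegralB_bounded; [|exact: b|exact: b].
have -> : e = e / 2 + (L ^+ 2 * m) / (e / 2) by rewrite /m; field; rewrite !gt_eqF.
apply: (@integral_sqr_bound _ (fun w => L * (S k w - Y w))).
- by apply: bounded_mfunB; exact: b.
- by apply: measurable_funM => //; exact: measurable_funB.
- by rewrite divr_gt0.
- move=> w; apply: le_trans (gK _ _) _; rewrite normrM (gtr0_norm L0) distrC ler_wpM2r//.
  by rewrite /L; apply: le_trans (ler_norm K) _; rewrite lerDl.
have -> : (\int[P]_w ((L * (S k w - Y w)) ^+ 2)%:E = (L ^+ 2)%:E * \int[P]_w ((S k w - Y w) ^+ 2)%:E)%E.
  rewrite -ge0_integralZl//; last 3 first.
  - by apply/measurable_EFinP; apply: measurable_funX; exact: measurable_funB.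
  - by move=> w _; rewrite lee_fin sqr_ge0.
  - by rewrite lee_fin sqr_ge0.
  by apply: eq_integral => w _; rewrite -EFinM exprMn.
have hk : (\int[P]_w ((S k w - Y w) ^+ 2)%:E)%E \is a fin_num by near: k.
rewrite -(fineK hk) -EFinM lte_fin ltr_pM2l ?exprn_gt0//.
have : `|0 - fine (\int[P]_w ((S k w - Y w) ^+ 2)%:E)%E| < m by near: k.
by rewrite sub0r normrN; apply: le_lt_trans; exact: ler_norm.
Unshelve. all: by end_near. Qed.

Lemma char_sqr_L2_cvg (S : nat -> T -> R) (Y : T -> R) (u : R) :
  (forall k, measurable_fun setT (S k)) -> measurable_fun setT Y ->
  (fun k => (\int[P]_w ((S k w - Y w) ^+ 2)%:E)%E) @ \oo --> 0%E ->
  (fun k => char_sqr P (S k) u) @ \oo --> char_sqr P Y u.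
Proof.
move=> mS mY cv.
have c1 := @Rintegral_trig_L2_cvg S Y (fun y => cos (u * y)) `|u| mS mY
  (measurable_cosM u) (fun y => cos_max _) _ cv.
have c2 := @Rintegral_trig_L2_cvg S Y (fun y => sin (u * y)) `|u| mS mY
  (measurable_sinM u) (fun y => sin_max _) _ cv.
have {}c1 : (fun k => \int[P]_w cos (u * S k w)) @ \oo --> \int[P]_w cos (u * Y w).
  by apply: c1 => x y; rewrite -normrM mulrBr; exact: norm_sub_cos_le.
have {}c2 : (fun k => \int[P]_w sin (u * S k w)) @ \oo --> \int[P]_w sin (u * Y w).
  by apply: c2 => x y; rewrite -normrM mulrBr; exact: norm_sub_sin_le.
by rewrite /char_sqr !expr2; exact: (cvgD (cvgM c1 c1) (cvgM c2 c2)).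
Qed.

End char_sqr_limit.

(** * The real part of the Levy-Khintchine exponent *)

Definition levy_exponent (R : realType) (nu : {measure set R -> \bar R}) (u : R) : R :=
  \int[nu]_x (1 - cos (u * x)).

Section levy_exponent.
Context (R : realType) (nu : {measure set R -> \bar R}).
Context (nu_fin : (\int[nu]_x (Num.min 1 (x ^+ 2))%:E < +oo)%E).
Local Notation psi := (levy_exponent nu).
Let m (x : R) : R := Num.min 1 (x ^+ 2).

Let m_ge0 x : 0 <= m x. Proof. by rewrite /m le_min ler01 sqr_ge0. Qed.

Let m_meas : measurable_fun setT m.
Proof. by apply: measurable_minr => //; exact: measurable_funX. Qed.

Let m_int : nu.-integrable setT (EFin \o m).
Proof.
apply/integrableP; split; first exact/measurable_EFinP.
by under eq_integral do rewrite /= ger0_norm//.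
Qed.

Let dominated_int (f : R -> R) (K : R) : measurable_fun setT f ->
  (forall x, 0 <= f x <= K * m x) -> nu.-integrable setT (EFin \o f).
Proof.
move=> mf hf; apply: (@le_integrable _ _ _ _ _ _ _ (fun x => K%:E * (EFin \o m) x)%E) => //.
- exact/measurable_EFinP.
- move=> x _ /=; have /andP[f0 fK] := hf x.
  by rewrite lee_fin !ger0_norm// (le_trans f0).
- exact: integrableZl.
Qed.

Let onem_cos_meas u : measurable_fun setT (fun x : R => 1 - cos (u * x)).
Proof. by apply: measurable_funB => //; exact: measurable_cosM. Qed.

Let onem_cos_m u x : 0 <= 1 - cos (u * x) <= (u ^+ 2 + 2) * m x.
Proof.
rewrite onem_cos_ge0/= /m; have h1 := onem_cos_le (u * x); have h2 := cos_geN1 (u * x).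
have u2 := sqr_ge0 u; have x2 := sqr_ge0 x.
rewrite exprMn in h1.
case: (leP 1 (x ^+ 2)) => hx; last by nra.
by rewrite mulr1; lra.
Qed.

Lemma onem_cos_integrable u : nu.-integrable setT (EFin \o (fun x => 1 - cos (u * x))).
Proof. by apply: dominated_int (onem_cos_m u). Qed.

Lemma levy_exponentE u : \int[nu]_x (cos (u * x) - 1) = - psi u.
Proof.
have -> : - psi u = -1 * psi u by rewrite mulN1r.
rewrite /levy_exponent -RintegralZl//; last exact: onem_cos_integrable.
by apply: eq_Rintegral => x _; rewrite mulN1r opprB.
Qed.

Lemma levy_exponent_ge0 u : 0 <= psi u.
Proof. by apply: Rintegral_ge0 => x _; exact: onem_cos_ge0. Qed.

Lemma levy_exponent_double u : psi (2 * u) <= 4 * psi u.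
Proof.
rewrite /levy_exponent -RintegralZl//; last exact: onem_cos_integrable.
apply: le_Rintegral => //; first exact: onem_cos_integrable.
  apply: (dominated_int (K := 4 * (u ^+ 2 + 2))).
    by apply: measurable_funM => //.
  move=> x; have /andP[h1 h2] := onem_cos_m u x.
  by rewrite mulr_ge0//= -mulrA ler_wpM2l.
by move=> x _; rewrite -mulrA; exact: onem_cos_double.
Qed.

Let small (n : nat) (x : R) : R := if `|x| <= n.+1%:R^-1 then m x else 0.

Let small_meas n : measurable_fun setT (small n).
Proof.
apply: measurable_fun_ifT => //.
by apply: measurable_fun_ler => //; exact: measurableT_comp.
Qed.

Let small_cvg : (fun n => (\int[nu]_x (small n x)%:E)%E) @ \oo --> 0%E.
Proof.
have DC := @dominated_convergence _ _ _ nu setT measurableT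
  (fun n x => (small n x)%:E) (cst 0%E) (EFin \o m).
have a1 : {ae nu, forall x, setT x -> (fun n => (small n x)%:E) @ \oo --> 0%E}.
  apply: aeW => x _; apply: cvg_EFin; first by apply: nearW.
  have [->|x0] := eqVneq x 0.
    rewrite (_ : (fun n => _) = cst 0); first exact: cvg_cst.
    by apply/funext => n; rewrite /small /m expr0n/= min_r// if_same.
  apply: cvg_near_cst; near=> n; rewrite /= /small ifF//; apply/negbTE; rewrite -ltNge.
  rewrite invf_plt ?posrE ?normr_gt0 ?ltr0n//.
  apply: (@lt_le_trans _ _ n%:R); last by rewrite ler_nat.
  by near: n; exact: nbhs_infty_gtr.
have a2 : {ae nu, forall x, forall n, setT x -> (`|(small n x)%:E| <= (m x)%:E)%E}.
  apply: aeW => x n _; rewrite lee_fin /small.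
  by case: ifP => _; rewrite ?normr0// ger0_norm.
have m1 n : measurable_fun setT (fun x => (small n x)%:E) by exact/measurable_EFinP.
have [_ _] := DC m1 (@measurable_cst _ _ _ _ _ _) a1 m_int a2.
by rewrite integral0.
Unshelve. all: by end_near. Qed.

(** Jumps with |x| <= 1/(n+1) contribute at most u^2/2 times the integral of [small n], which tends
    to 0. For the others 1 - cos(u x) <= 2 <= 2 (n+1)^2 m(x), a bound without u. *)
Lemma levy_exponent_growth (eps : R) : 0 < eps ->
  exists lam : R, forall u, psi u <= eps * u ^+ 2 + lam.
Proof.
move=> eps0.
have [n hn] : exists n, (\int[nu]_x (small n x)%:E < (2 * eps)%:E)%E.
  have e0 : 0 < 2 * eps by rewrite mulr_gt0.
  have [hfin /cvgrPdist_lt/(_ _ e0) hm] := (fine_cvgP _ _).1 small_cvg.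
  have [n [h1 h2]] := filter_ex (filterI hfin hm); exists n.
  rewrite -(fineK h1) lte_fin; apply: le_lt_trans h2.
  by rewrite sub0r normrN; exact: ler_norm.
have small_le x : 0 <= small n x <= 1 * m x.
  by rewrite mul1r /small; case: ifP; rewrite ?lexx ?m_ge0.
have small_int := dominated_int (small_meas n) small_le.
have hn' : \int[nu]_x small n x <= 2 * eps.
  by rewrite /Rintegral -lee_fin fineK ?ltW//; exact: integrable_fin_num.
exists (2 * n.+1%:R ^+ 2 * \int[nu]_x m x) => u.
have u2 := sqr_ge0 u.
apply: (@le_trans _ _ (\int[nu]_x ((u ^+ 2 / 2) * small n x + 2 * n.+1%:R ^+ 2 * m x))).
  have iS : nu.-integrable setT (EFin \o (fun x => (u ^+ 2 / 2) * small n x)).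
    apply: (dominated_int (K := u ^+ 2 / 2)).
      by apply: measurable_funM => //; exact: small_meas.
    move=> x; have /andP[h1 h2] := small_le x; rewrite mul1r in h2.
    by rewrite mulr_ge0 ?divr_ge0//= ler_wpM2l// divr_ge0.
  have iM : nu.-integrable setT (EFin \o (fun x => 2 * n.+1%:R ^+ 2 * m x)).
    apply: (dominated_int (K := 2 * n.+1%:R ^+ 2)); first exact: measurable_funM.
    by move=> x; rewrite lexx andbT !mulr_ge0// exprn_ge0.
  apply: le_Rintegral => //; first exact: onem_cos_integrable.
    by have := integrableD measurableT iS iM; congr (nu.-integrable _ _); apply/funext => x.
  move=> x _; rewrite /small.
  have n0 : 0 < n.+1%:R :> R by rewrite ltr0n.
  have x2 := sqr_ge0 x.
  case: ifPn => [xn|]; last first.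
    rewrite -ltNge mulr0 add0r => xn.
    have hm : (n.+1%:R ^+ 2)^-1 <= m x.
      rewrite /m le_min invf_le1 ?exprn_gt0// exprn_ege1 ?ler1n//=.
      by rewrite -[x ^+ 2]real_normK ?num_real// -exprVn lerXn2r ?nnegrE ?invr_ge0// ltW.
    have h2 := cos_geN1 (u * x).
    apply: (@le_trans _ _ 2); first by lra.
    rewrite -mulrA -[leLHS]mulr1 ler_wpM2l// mulrC -ler_pdivrMr ?exprn_gt0//.
    by rewrite mul1r.
  have x1 : x ^+ 2 <= 1.
    rewrite -[x ^+ 2]real_normK ?num_real//; apply: exprn_ile1 => //.
    by apply: le_trans xn _; rewrite invf_le1// ler1n.
  have := onem_cos_le (u * x); rewrite exprMn /m min_r// => h.
  have : 0 <= 2 * n.+1%:R ^+ 2 * x ^+ 2 :> R.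
    by apply: mulr_ge0 => //; apply: mulr_ge0 => //; exact: sqr_ge0.
  lra.
rewrite RintegralD//; last 2 first.
- apply: (dominated_int (K := u ^+ 2 / 2)).
    by apply: measurable_funM => //; exact: small_meas.
  move=> x; have /andP[h1 h2] := small_le x; rewrite mul1r in h2.
  by rewrite mulr_ge0 ?divr_ge0//= ler_wpM2l// divr_ge0.
- apply: (dominated_int (K := 2 * n.+1%:R ^+ 2)); first exact: measurable_funM.
  by move=> x; rewrite lexx andbT !mulr_ge0// exprn_ge0.
rewrite !RintegralZl// lerD2r.
have := ler_wpM2l u2 hn'; lra.
Qed.

End levy_exponent.

(** * The exponent of a centred variable with finite second moment *)

Section second_moment.
Context d (T : measurableType d) (R : realType) (P : probability T R) (X : T -> R)
  (mX : measurable_fun setT X) (X2 : (\int[P]_w (X w ^+ 2)%:E < +oo)%E)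
  (psi : R -> R) (psiE : forall u, char_sqr P X u = expR (- (2 * psi u))).

Let V : R := \int[P]_w X w ^+ 2.

Let mX2 : measurable_fun setT (fun w => X w ^+ 2). Proof. exact: measurable_funX. Qed.

Let iX2 : P.-integrable setT (EFin \o (fun w => X w ^+ 2)).
Proof.
apply/integrableP; split; first exact/measurable_EFinP.
by under eq_integral do rewrite /= ger0_norm ?sqr_ge0//.
Qed.

Let iZX2 (c : R) : P.-integrable setT (EFin \o (fun w => c * X w ^+ 2)).
Proof. by have := @integrableZl _ _ _ P setT measurableT c _ iX2. Qed.

Let V_ge0 : 0 <= V. Proof. by apply: Rintegral_ge0 => w _; exact: sqr_ge0. Qed.

Let c u : R := \int[P]_w cos (u * X w).
Let s u : R := \int[P]_w sin (u * X w).

Let muX u : measurable_fun setT (fun w => u * X w). Proof. exact: measurable_funM. Qed.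

Let onem_c u : 1 - c u = \int[P]_w (1 - cos (u * X w)).
Proof.
rewrite RintegralB_bounded ?Rintegral_prob_cst//; first exact: bounded_mfun_cst.
exact: cos_comp_bounded.
Qed.

Let b1c u : bounded_mfun (fun w => 1 - cos (u * X w)).
Proof. by apply: bounded_mfunB; [exact: bounded_mfun_cst|exact: cos_comp_bounded]. Qed.

Let onem_c_le u : 1 - c u <= u ^+ 2 / 2 * V.
Proof.
rewrite onem_c /V -RintegralZl//; apply: le_Rintegral => //.
  exact: bounded_mfun_integrable.
by move=> w _; have := onem_cos_le (u * X w); rewrite exprMn mulrAC.
Qed.

Let c_itv u : -1 <= c u <= 1.
Proof.
rewrite -ler_norml; apply: norm_Rintegral_bounded; last by move=> w; exact: cos_max.
by have [] := cos_comp_bounded (muX u).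
Qed.

(** The cosine part suffices: 1 - c^2 = (1 - c)(1 + c) <= 2 (1 - c) <= u^2 V. *)
Lemma char_sqr_ge u : 1 - u ^+ 2 * V <= char_sqr P X u.
Proof.
rewrite /char_sqr -/(c u) -/(s u).
have := onem_c_le u; have /andP[] := c_itv u; have := sqr_ge0 (s u).
set C := c u; set S := s u ^+ 2; nra.
Qed.

(* Near 0 this comes from the second moment; doubling the argument extends it. *)
Lemma exponent_le_sqr (psi2 : forall u, psi (2 * u) <= 4 * psi u) u :
  psi u <= V * u ^+ 2.
Proof.
(* The threshold 1/2 is where (1 - y)(1 + 2y) >= 1 ends, which gives exp(-2y) <= 1/(1 + 2y) <= 1 -
   y. Each doubling of u multiplies it by 4. *)
have h k : forall u, u ^+ 2 * V <= 4 ^+ k / 2 -> psi u <= V * u ^+ 2.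
  elim: k => [|k ih] v.
    rewrite expr0 mul1r => hv.
    have := char_sqr_ge v; rewrite psiE => h1.
    rewrite [leRHS]mulrC; move: hv h1; set y := v ^+ 2 * V => hv h1.
    have y0 : 0 <= y by rewrite mulr_ge0// sqr_ge0.
    have h2 := expR_ge1Dx (2 * y).
    have : expR (- (2 * y)) <= expR (- (2 * psi v)).
      apply: le_trans h1; rewrite expRN -[leLHS]mul1r ler_pdivrMr ?expR_gt0//.
      by have := expR_gt0 (2 * y); nra.
    by rewrite ler_expR lerN2 ler_pM2l.
  have e2 : 2 * (v / 2) = v by field.
  have e4 : (v / 2) ^+ 2 = v ^+ 2 / 4 by field.
  move=> hv; rewrite -[X in psi X]e2; apply: le_trans (psi2 _) _.
  have : psi (v / 2) <= V * (v / 2) ^+ 2.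
    by apply: ih; rewrite e4; move: hv; rewrite [4 ^+ k.+1]exprS; lra.
  by rewrite e4; lra.
have [k hk] : exists k, u ^+ 2 * V <= 4 ^+ k / 2 :> R.
  exists (Num.truncn (2 * (u ^+ 2 * V))).+1.
  have y0 : 0 <= 2 * (u ^+ 2 * V) by rewrite mulr_ge0// mulr_ge0// sqr_ge0.
  have /andP[_] := truncn_itv y0.
  set n := (Num.truncn _).+1 => hn.
  rewrite ler_pdivlMr// mulrC; apply: le_trans (ltW hn) _.
  by rewrite -natrX ler_nat ltnW// ltn_expl.
exact: h hk.
Qed.

Context (iX0 : (\int[P]_w (X w)%:E = 0)%E).

Let iX : P.-integrable setT (EFin \o X).
Proof.
apply: (@le_integrable _ _ _ _ _ _ _ (EFin \o (fun w => 1 + X w ^+ 2))) => //.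
- exact/measurable_EFinP.
- move=> w _ /=; rewrite lee_fin [leRHS]ger0_norm; last by rewrite addr_ge0// sqr_ge0.
  rewrite -[X w ^+ 2]real_normK ?num_real//.
  by have := sqr_ge0 (`|X w| - 1); have := normr_ge0 (X w); nra.
- have := integrableD measurableT (bounded_mfun_integrable P (bounded_mfun_cst T (1 : R))) iX2.
  by congr (P.-integrable _ _); apply/funext.
Qed.

Let s_le u : `|s u| <= u ^+ 2 * V.
Proof.
have iuX : P.-integrable setT (EFin \o (fun w => u * X w)).
  by have := @integrableZl _ _ _ P setT measurableT u _ iX.
have is_ := bounded_mfun_integrable P (sin_comp_bounded (muX u)).
have -> : s u = \int[P]_w (sin (u * X w) - u * X w).
  have e : \int[P]_w X w = 0 by rewrite /Rintegral iX0.
  by rewrite RintegralB// RintegralZl// e mulr0 subr0.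
have iB : P.-integrable setT (EFin \o (fun w => sin (u * X w) - u * X w)).
  by have := integrableB measurableT is_ iuX; congr (P.-integrable _ _); apply/funext.
apply: le_trans (le_normr_Rintegral _ _) _ => //.
rewrite /V -RintegralZl//; apply: le_Rintegral => //.
  by have := integrable_norm iB; congr (P.-integrable _ _); apply/funext.
by move=> w _; rewrite -exprMn; exact: norm_sin_sub_id_le.
Qed.

(** X charges some annulus [A n], where 1 - cos(u X) is of order u^2, so that c u <= 1 - q u^2 for
    small u. Because X is centred, s u is O(u^2), and its square cannot make up for this loss. *)
Lemma exponent_ge_sqr : P [set w | X w != 0] <> 0%E ->
  exists c0 u0 : R, [/\ 0 < c0, 0 < u0 & forall u, `|u| <= u0 -> c0 * u ^+ 2 <= psi u].
Proof.
move=> PX.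
pose A (n : nat) : set R := [set x | n.+1%:R^-1 <= `|x| <= n.+1%:R].
have mA n : measurable (A n).
  rewrite (_ : A n = (fun x : R => `|x|) @^-1` `[n.+1%:R^-1, n.+1%:R]%classic); last first.
    by apply/seteqP; split => x /=; rewrite in_itv.
  by rewrite -[X in measurable X]setTI; apply: normr_measurable => //; exact: measurable_itv.
have mXA n : measurable [set w | A n (X w)].
  by rewrite -[X in measurable X]setTI; exact: mX.
have [n Pn] : exists n, P [set w | A n (X w)] <> 0%E.
  apply: contrapT => h; apply: PX.
  have h0 n : P [set w | A n (X w)] = 0%E by apply: contrapT => h1; apply: h; exists n.
  have ng : P.-negligible (\bigcup_n [set w | A n (X w)]).
    by apply: negligible_bigcup => n; apply/negligibleP => //; exact: h0.
  have mU : measurable [set w | X w != 0].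
    rewrite (_ : [set _ | _] = X @^-1` (~` [set 0])).
      by rewrite -[X in measurable X]setTI; apply: mX => //; apply: measurableC.
    by apply/seteqP; split => w /= /eqP.
  apply/negligibleP => //; apply: negligibleS ng => w /= w0.
  have x0 : 0 < `|X w| by rewrite normr_gt0.
  pose N := maxn (Num.truncn `|X w|) (Num.truncn `|X w|^-1).
  have tn (y : R) : 0 <= y -> y < (Num.truncn y).+1%:R.
    by move=> y0; have /andP[] := truncn_itv y0.
  exists N => //=; apply/andP; split.
    rewrite invf_ple ?posrE ?ltr0n//; apply/ltW; apply: lt_le_trans (tn _ _) _.
      by rewrite invr_ge0.
    by rewrite ler_nat ltnS leq_maxr.
  apply/ltW; apply: lt_le_trans (tn _ _) _ => //.
  by rewrite ler_nat ltnS leq_maxl.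
pose p : R := fine (P [set w | A n (X w)]).
have p0 : 0 < p.
  rewrite /p fine_gt0// lt0e measure_ge0 andbT; apply/andP; split; first exact/eqP.
  by rewrite -ge0_fin_numE ?measure_ge0// fin_num_measure.
pose k : R := n.+1%:R.
have k1 : 1 <= k by rewrite ler1n.
(* On [A n], |u| <= 1/k makes |u X| <= 1, so [onem_cos_ge] applies and yields u^2 X^2 / 8 >= u^2 /
   (8 k^2). *)
pose q := p / (8 * k ^+ 2).
have q0 : 0 < q by rewrite divr_gt0// mulr_gt0// exprn_gt0//; lra.
have onem_c_ge u : `|u| <= k^-1 -> u ^+ 2 * q <= 1 - c u.
  move=> uk; rewrite onem_c.
  have -> : u ^+ 2 * q = \int[P]_w (u ^+ 2 / (8 * k ^+ 2) * (\1_(A n) (X w) : R)).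
    rewrite RintegralZ_bounded; last exact: bounded_mfun_indic.
    by rewrite Rintegral_indic_comp// /q /p; ring.
  apply: le_Rintegral_bounded => //.
    by apply: bounded_mfunM; [exact: bounded_mfun_cst|exact: bounded_mfun_indic].
  move=> w; rewrite indicE; case: (boolP (X w \in A n)) => [/set_mem/andP[x1 x2]|_]; last first.
    by rewrite mulr0; exact: onem_cos_ge0.
  have k0 : 0 < k by lra.
  rewrite mulr1; apply: le_trans (onem_cos_ge _); last first.
    rewrite normrM; apply: (@le_trans _ _ (k^-1 * k)); first exact: ler_pM.
    by rewrite mulVf// gt_eqF.
  rewrite exprMn invfM mulrA mulrAC ler_wpM2r// ler_wpM2l ?sqr_ge0//.
  rewrite -[X w ^+ 2]real_normK ?num_real// -exprVn lerXn2r ?nnegrE ?invr_ge0//.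
(* u^2 <= r yields both u^2 V <= 1, hence c u >= 0, and u^2 V^2 <= q/2, hence (s u)^2 <= u^2 q/2. *)
pose r := Num.min 1 (q / 2) / (1 + V + V ^+ 2).
have V2 : 0 <= V ^+ 2 by exact: sqr_ge0.
have d1 : 1 <= 1 + V + V ^+ 2 by rewrite -addrA lerDl addr_ge0.
have d0 : 0 < 1 + V + V ^+ 2 by apply: lt_le_trans d1.
have r0 : 0 < r by rewrite divr_gt0// lt_min ltr01 divr_gt0.
have r1 : r <= 1.
  by rewrite ler_pdivrMr// mul1r; apply: (@le_trans _ _ 1); first by rewrite ge_min lexx.
exists (q / 4), (Num.min k^-1 r); split.
- by rewrite divr_gt0.
- by rewrite lt_min invr_gt0 r0 andbT; lra.
move=> u; rewrite le_min => /andP[uk ur].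
have u2 : u ^+ 2 <= r.
  rewrite -[u ^+ 2]real_normK ?num_real// expr2 -[leRHS]mul1r.
  by apply: ler_pM => //; apply: le_trans ur r1.
have hr : r * (1 + V + V ^+ 2) = Num.min 1 (q / 2) by rewrite divfK// gt_eqF.
have m1 : Num.min 1 (q / 2) <= 1 by rewrite ge_min lexx.
have m2 : Num.min 1 (q / 2) <= q / 2 by rewrite ge_min lexx orbT.
have uu0 := sqr_ge0 u.
have h1 : u ^+ 2 * V <= 1 by nra.
have h2 : u ^+ 2 * V ^+ 2 <= q / 2.
  apply: le_trans m2; rewrite -hr; apply: (@le_trans _ _ (r * V ^+ 2)).
    exact: ler_wpM2r.
  by rewrite ler_pM2l// lerDr addr_ge0.
have hs : s u ^+ 2 <= u ^+ 2 * (q / 2).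
  have : `|s u| ^+ 2 <= (u ^+ 2 * V) ^+ 2.
    have uV0 : 0 <= u ^+ 2 * V by rewrite mulr_ge0.
    by apply: lerXn2r => //; exact: s_le.
  rewrite real_normK ?num_real// => h; apply: le_trans h _.
  by rewrite exprMn expr2 -mulrA ler_wpM2l.
have hc := onem_c_ge u uk.
have hc' := onem_c_le u.
have /andP[_ c1] := c_itv u.
have hM : char_sqr P X u <= 1 - u ^+ 2 * (q / 2).
  rewrite /char_sqr -/(c u) -/(s u).
  (* On [0, 1] one has c^2 <= c <= 1 - q u^2; half of the loss q u^2 survives the sine part. *)
  have c0 : 0 <= c u by lra.
  move: hs hc c1 c0; set C := c u; set S := s u ^+ 2 => *; nra.
have := expR_ge1Dx (- (2 * psi u)); rewrite -psiE; lra.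
Qed.

End second_moment.

(** * Increments of a Levy process *)

Section levy.
Context d (T : measurableType d) (R : realType) (P : probability T R) (L : R -> {RV P >-> R})
  (levyL : levy_process L).

Let mL t : measurable_fun setT (L t). Proof. exact: measurable_funPT. Qed.

Let inc (h : R) (i : nat) (w : T) : R := L (i.+1%:R * h) w - L (i%:R * h) w.

Let minc h i : measurable_fun setT (inc h i).
Proof. exact: measurable_funB. Qed.

Let inc_indep (h : R) (n : nat) : 0 <= h -> forall B : nat -> set R, (forall i, measurable (B i)) ->
  P [set w | forall i : 'I_n, B i (inc h i w)] = (\prod_(i < n) P [set w | B i (inc h i w)])%E.
Proof.
move=> h0 B mB; have [_ ind _ _ _] := levyL.
have mono k : (k < n)%N -> k%:R * h <= k.+1%:R * h by move=> _; rewrite ler_wpM2r// ler_nat.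
have t0 : 0 <= 0%:R * h by rewrite mul0r.
exact: (ind n (fun k => k%:R * h) t0 mono (fun i : 'I_n => B i) (fun i => mB i)).
Qed.

Let inc_law (h : R) (i : nat) (B : set R) : 0 <= h -> measurable B ->
  P [set w | B (inc h i w)] = P [set w | B (L h w)].
Proof.
move=> h0 mB; have [_ _ st _ _] := levyL.
by rewrite -(st (i%:R * h) h B)// ?mulr_ge0// /inc -nat1r mulrDl mul1r.
Qed.

Let L_law0 (t : R) (B : set R) : 0 <= t -> measurable B ->
  P [set w | B (L t w - L 0 w)] = P [set w | B (L t w)].
Proof.
by move=> t0 mB; have [_ _ st _ _] := levyL; rewrite -(st 0 t B)// addr0.
Qed.

Lemma char_sqr_stepint (h : R) (n : nat) (a : 'I_n -> R) (u : R) : 0 <= h ->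
  char_sqr P (stepint (fun t w => L t w) a (@grid_l R h n) (@grid_r R h n)) u =
  \prod_(i < n) char_sqr P (L h) (u * a i).
Proof.
move=> h0; pose a' (k : nat) : R := oapp a 0 (insub k).
have a'E (i : 'I_n) : a' i = a i by rewrite /a' valK.
have := @char_sqr_independent_sum _ _ _ P n (inc h) (minc h) (@inc_indep h n h0) a' u.
have -> : (fun w => \sum_(i < n) a' i * inc h i w) =
    stepint (fun t w => L t w) a (@grid_l R h n) (@grid_r R h n).
  by apply/funext => w; apply: eq_bigr => i _; rewrite a'E.
move=> ->; apply: eq_bigr => i _; rewrite a'E.
by apply: char_sqr_eq_dist => // B mB; exact: inc_law.
Qed.

Lemma sum_increments (h : R) (n : nat) (w : T) :
  \sum_(i < n) inc h i w = L (n%:R * h) w - L 0 w.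
Proof.
elim: n => [|n ih]; first by rewrite big_ord0 mul0r subrr.
by rewrite big_ord_recr/= ih /inc addrC addrA subrK.
Qed.

Let invn_ge0 (N : nat) : 0 <= N%:R^-1 :> R. Proof. by rewrite invr_ge0. Qed.

Section exponent.
Context (psi : R -> R) (psiE : forall u, char_sqr P (L 1) u = expR (- (2 * psi u))).

(** L_1 has the law of L_1 - L_0, a sum of N independent increments with the law of L_(1/N). The
    squared moduli are nonnegative, so the N-th root is determined. *)
Lemma char_sqr_levy_invn (N : nat) (u : R) : (0 < N)%N ->
  char_sqr P (L N%:R^-1) u = expR (- (2 * psi u) / N%:R).
Proof.
move=> N0; have n0 : N%:R != 0 :> R by rewrite pnatr_eq0 -lt0n.
have := @char_sqr_stepint N%:R^-1 N (fun=> 1) u (invn_ge0 N).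
rewrite prodr_const card_ord mulr1.
have -> : char_sqr P (stepint (fun t w => L t w) (fun=> 1) (@grid_l R N%:R^-1 N) (@grid_r R N%:R^-1 N)) u
    = expR (- (2 * psi u)).
  rewrite -psiE; apply: char_sqr_eq_dist => // [|B mB].
    by apply: measurable_sum => i; apply: measurable_funM => //; exact: measurable_funB.
  rewrite -(@L_law0 1 B)//; congr (P _); apply/seteqP; split => w /=;
  rewrite /stepint (eq_bigr (fun i : 'I_N => inc N%:R^-1 i w)) ?sum_increments ?divff//;
  by move=> i _; rewrite mul1r.
move=> h; set M := char_sqr _ _ _ in h *.
have M0 : 0 <= M by rewrite addr_ge0// sqr_ge0.
apply/eqP; rewrite -(eqrXn2 N0)// ?expR_ge0//; apply/eqP.
by rewrite -h -expRM_natr divfK.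
Qed.

Lemma char_sqr_stepintE (N n : nat) (a : 'I_n -> R) (u : R) : (0 < N)%N ->
  char_sqr P (stepint (fun t w => L t w) a (@grid_l R N%:R^-1 n) (@grid_r R N%:R^-1 n)) u =
  expR (- (2 * (N%:R^-1 * \sum_(i < n) psi (u * a i)))).
Proof.
move=> N0; rewrite char_sqr_stepint//.
under eq_bigr do rewrite char_sqr_levy_invn//.
rewrite -expR_sum; congr expR.
rewrite mulrA mulr_sumr -sumrN; apply: eq_bigr => i _; ring.
Qed.

End exponent.

(** * Vanishing of L_1 forces the whole process to vanish *)

Section zero_process.
Context (L1 : P [set w | L 1 w != 0] = 0%E).

Let mset (X : T -> R) (B : set R) : measurable_fun setT X -> measurable B ->
  measurable [set w | B (X w)].
Proof. by move=> mX mB; rewrite -[X in measurable X]setTI; exact: mX. Qed.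

Let ne0 : set R := ~` [set 0].
Let mne0 : measurable ne0. Proof. exact: measurableC. Qed.
Let ne0E (X : T -> R) : [set w | X w != 0] = [set w | ne0 (X w)].
Proof. by apply/seteqP; split => w /= /eqP. Qed.

Let prob0S (A B : set T) : measurable A -> measurable B -> A `<=` B -> P B = 0%E -> P A = 0%E.
Proof.
by move=> mA mB AB B0; apply/eqP; rewrite eq_le measure_ge0 andbT -B0 le_measure// inE.
Qed.

Let prob0U (A B : set T) : measurable A -> measurable B -> P A = 0%E -> P B = 0%E ->
  P (A `|` B) = 0%E.
Proof.
move=> mA mB A0 B0; apply/eqP; rewrite eq_le measure_ge0 andbT.
apply: (@le_trans _ _ (P A + P B)%E); first exact: measureU2.
by rewrite A0 B0 adde0.
Qed.

(* If all [N] increments lie in [B], so does their sum, and [L_1 <> L_0]. *)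
Lemma levy_sign_zero (N : nat) (B : set R) : (0 < N)%N -> measurable B -> ~ B 0 ->
  (forall x y, B x -> B y -> B (x + y)) -> P [set w | B (L N%:R^-1 w)] = 0%E.
Proof.
move=> N0 mB B0 BD; set h : R := N%:R^-1.
have n0 : N%:R != 0 :> R by rewrite pnatr_eq0 -lt0n.
have h0 : 0 <= h by exact: invn_ge0.
have e : (P [set w | B (L h w)]) = (fine (P [set w | B (L h w)]))%:E.
  by rewrite fineK// fin_num_measure//; exact: mset.
have := @inc_indep h N h0 (fun=> B) (fun=> mB).
under eq_bigr do rewrite (inc_law _ h0 mB) e.
rewrite -(big_morph EFin EFinM (erefl _)) prodr_const card_ord => hp.
have hsum (f : nat -> R) n : (0 < n)%N -> (forall i : 'I_n, B (f i)) -> B (\sum_(i < n) f i).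
  case: n => // n _; elim: n => [|n ih] hf; first by rewrite big_ord1; exact: (hf ord0).
  rewrite big_ord_recr/=; apply: BD; last exact: (hf ord_max).
  by apply: ih => i; exact: (hf (widen_ord (leqnSn _) i)).
have z : P [set w | forall i : 'I_N, B (inc h i w)] = 0%E.
  apply: (@prob0S _ [set w | ne0 (L 1 w - L 0 w)]).
  - rewrite (_ : [set _ | _] = \bigcap_(i < N) [set w | B (inc h i w)]).
      by apply: bigcap_measurableType => i _; exact: mset.
    by apply/seteqP; split => w /= hw i; [move=> /= ilt; exact: (hw (Ordinal ilt))|exact: (hw i (ltn_ord i))].
  - by apply: mset => //; exact: measurable_funB.
  - move=> w /= hw; rewrite -[1](@divff _ N%:R)// -sum_increments => s0; apply: B0; rewrite -s0.
    exact: (hsum (fun i => inc N%:R^-1 i w) N N0 hw).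
  - by rewrite L_law0//; have <- := ne0E (L 1).
rewrite z in hp; have /eqP := esym (EFin_inj hp); rewrite expf_eq0 => /andP[_ /eqP p0].
by rewrite e p0.
Qed.

(** Both open half-lines are closed under addition and omit 0, so [levy_sign_zero] applies to
    each. *)
Lemma levy_invn_zero (N : nat) : (0 < N)%N -> P [set w | L N%:R^-1 w != 0] = 0%E.
Proof.
move=> N0.
have hp : P [set w | [set x : R | 0 < x] (L N%:R^-1 w)] = 0%E.
  apply: levy_sign_zero => //=; first by rewrite -set_itvoy; exact: measurable_itv.
    by rewrite ltxx.
  by move=> x y; exact: addr_gt0.
have hn : P [set w | [set x : R | x < 0] (L N%:R^-1 w)] = 0%E.
  apply: levy_sign_zero => //=; first by rewrite -set_itvNyo; exact: measurable_itv.
    by rewrite ltxx.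
  by move=> x y; lra.
apply: (@prob0S _ ([set w | 0 < L N%:R^-1 w] `|` [set w | L N%:R^-1 w < 0])).
- by rewrite ne0E; exact: mset.
- apply: measurableU; [apply: (mset _ (B := [set x | 0 < x]))|apply: (mset _ (B := [set x | x < 0]))] => //.
    by rewrite -set_itvoy; exact: measurable_itv.
  by rewrite -set_itvNyo; exact: measurable_itv.
- by move=> w /=; rewrite neq_lt => /orP[h|h]; [right|left].
- apply: prob0U => //.
    by apply: (mset _ (B := [set x | 0 < x])) => //; rewrite -set_itvoy; exact: measurable_itv.
  by apply: (mset _ (B := [set x | x < 0])) => //; rewrite -set_itvNyo; exact: measurable_itv.
Qed.

Lemma levy_rat_zero (N k : nat) : (0 < N)%N -> P [set w | L (k%:R * N%:R^-1) w != 0] = 0%E.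
Proof.
move=> N0; set h : R := N%:R^-1.
elim: k => [|k ih]; first by rewrite mul0r; have [] := levyL.
apply: (@prob0S _ ([set w | L (k%:R * h) w != 0] `|` [set w | ne0 (inc h k w)])).
- by rewrite ne0E; exact: mset.
- by apply: measurableU; [rewrite ne0E|]; exact: mset.
- move=> w /= w0; have [e|e] := eqVneq (L (k%:R * h) w) 0; last by left.
  by right => /eqP; rewrite /inc e subr0; exact/negP.
- apply: prob0U => //; [by rewrite ne0E; exact: mset|exact: mset|].
  apply: (etrans (inc_law k (invn_ge0 N) mne0)).
  by rewrite -[RHS](levy_invn_zero N0); congr (P _); exact/esym/ne0E.
Qed.

(** Rational times are settled by adding increments; stochastic continuity carries the result over
    to real times. *)
Lemma levy_zero (t : R) : 0 <= t -> P [set w | L t w != 0] = 0%E.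
Proof.
move=> t0; have [_ _ _ sc _] := levyL.
have mE e : measurable [set w | e < `|L t w|].
  apply: (mset (B := [set x : R | e < `|x|])) => //.
  rewrite (_ : [set _ | _] = (fun x : R => `|x|) @^-1` `]e, +oo[%classic); last first.
    by apply/seteqP; split => x /=; rewrite in_itv/= andbT.
  by rewrite -[X in measurable X]setTI; apply: normr_measurable => //; exact: measurable_itv.
have small (e : R) : 0 < e -> P [set w | e < `|L t w|] = 0%E.
  move=> e0; apply/eqP; rewrite eq_le measure_ge0 andbT.
  apply/lee_addgt0Pr => eta eta0; rewrite add0e.
  have [de de0 hde] := sc t e eta t0 e0 eta0.
  (* k/N is within 1/N < de below t. *)
  pose N := (Num.truncn de^-1).+1; pose k := Num.truncn (t * N%:R).
  have n0 : 0 < N%:R :> R by rewrite ltr0n.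
  have hN : de^-1 < N%:R.
    have /andP[] : (Num.truncn de^-1)%:R <= de^-1 < (Num.truncn de^-1).+1%:R.
      by apply: truncn_itv; rewrite invr_ge0 ltW.
    by [].
  have /andP[k1 k2] : k%:R <= t * N%:R < k.+1%:R.
    by apply: truncn_itv; rewrite mulr_ge0.
  have hs : `|k%:R * N%:R^-1 - t| < de.
    have a1 : k%:R * N%:R^-1 <= t by rewrite ler_pdivrMr.
    have a2 : t < k%:R * N%:R^-1 + N%:R^-1.
      by rewrite -[X in _ + X]mul1r -mulrDl natr1 ltr_pdivlMr.
    have a3 : N%:R^-1 < de by rewrite invf_plt.
    by rewrite ltr_norml; lra.
  have s0 : 0 <= k%:R * N%:R^-1 :> R by rewrite mulr_ge0.
  have := hde _ s0 hs; set s := k%:R * N%:R^-1 => hP.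
  have mD : measurable [set w | e < `|L s w - L t w|].
    apply: (mset (X := fun w => L s w - L t w) (B := [set x : R | e < `|x|])).
      exact: measurable_funB.
    rewrite (_ : [set _ | _] = (fun x : R => `|x|) @^-1` `]e, +oo[%classic); last first.
      by apply/seteqP; split => x /=; rewrite in_itv/= andbT.
    by rewrite -[X in measurable X]setTI; apply: normr_measurable => //; exact: measurable_itv.
  have mS : measurable [set w | L s w != 0] by rewrite ne0E; exact: mset.
  apply: (@le_trans _ _ (P ([set w | L s w != 0] `|` [set w | e < `|L s w - L t w|]))).
    apply: le_measure; [exact: mem_set|apply: mem_set; exact: measurableU|].
    move=> w /= ew; have [z|z] := eqVneq (L s w) 0; last by left.
    by right; rewrite z sub0r normrN.
  apply: (@le_trans _ _ (P [set w | (L s w != 0)%R] + P [set w | (e < `|L s w - L t w|)%R])%E).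
    exact: measureU2.
  by rewrite levy_rat_zero// add0e ltW.
have ng : P.-negligible (\bigcup_n [set w | n.+1%:R^-1 < `|L t w|]).
  apply: negligible_bigcup => n; apply/negligibleP => //.
  by apply: small; rewrite invr_gt0.
apply/negligibleP; first by rewrite ne0E; exact: mset.
apply: negligibleS ng => w /= w0.
have x0 : 0 < `|L t w| by rewrite normr_gt0.
exists (Num.truncn `|L t w|^-1) => //=.
have /andP[_ h] : (Num.truncn `|L t w|^-1)%:R <= `|L t w|^-1 < (Num.truncn `|L t w|^-1).+1%:R.
  by apply: truncn_itv; rewrite invr_ge0.
by rewrite -[ltRHS]invrK ltf_pV2// posrE ?invr_gt0// ltr0n.
Qed.

End zero_process.
End levy.

(** * Positivity of the normalizing constant *)

(** Both majorants have known integrals: [ushape] takes the singularity at 0, and 4 times the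
    exponential density of rate 1/2, that is 2 exp(-t/2), takes the tail, where t^(x-1) <= 2
    exp(t/2). *)
Lemma Gamma_integrand_le (R : realType) (x t : R) : 0 < x < 2 -> 0 < t ->
  t `^ (x - 1) * expR (- t) <=
  (if t < 1 then ushape 1 (Num.max 0 (1 - x)) t else 0) + 4 * exponential_pdf 2^-1 t.
Proof.
move=> /andP[x0 x2] t0.
have pdfE : 4 * exponential_pdf 2^-1 t = 2 * expR (- (t / 2)).
  rewrite /exponential_pdf patchE mem_set; last by rewrite /= in_itv/= andbT ltW.
  have -> : - 2^-1 * t = - (t / 2) by ring.
  by rewrite mulrA; congr (_ * _); lra.
rewrite pdfE; have e0 := expR_gt0 (- (t / 2)); have u0 := ushape_ge0 1 (Num.max 0 (1 - x)) t.
have p0 := powR_ge0 t (x - 1).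
have [th|th] := leP t 2^-1.
  rewrite ifT; last by lra.
  apply: (@le_trans _ _ (ushape 1 (Num.max 0 (1 - x)) t)); last by rewrite lerDl; lra.
  apply: (@le_trans _ _ (t `^ (x - 1))).
    rewrite -[leRHS]mulr1 ler_wpM2l// -[leRHS]expR0 ler_expR; lra.
  rewrite /ushape divr1 min_l; last by lra.
  by apply: ger_powR; [lra|case: (leP 0 (1 - x)) => hx; lra].
apply: (@le_trans _ _ (2 * expR (- (t / 2)))); last by rewrite lerDr; case: ifP.
have -> : expR (- t) = expR (- (t / 2)) * expR (- (t / 2)).
  by rewrite -expRD; congr expR; lra.
rewrite mulrA ler_pM2r//.
rewrite expRN -[leLHS]/(_ / _) ler_pdivrMr ?expR_gt0//.
have h := expR_ge1Dx (t / 2).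
have [t1|t1] := leP 1 t.
  apply: (@le_trans _ _ t); last by lra.
  by rewrite -[leRHS]powRr1 ?(ltW t0)//; apply: ler_powR; lra.
apply: (@le_trans _ _ 2); last by lra.
apply: (@le_trans _ _ (t `^ (-1))).
  by apply: ger_powR; lra.
rewrite powR_inv1 ?(ltW t0)//; rewrite -[leRHS]invrK lef_pV2 ?posrE//; lra.
Qed.

(** [Rintegral] would be 0 for an infinite integral, so positivity needs finiteness besides a lower
    bound on [1, 2]. The range (0, 2) contains the three arguments in [cH]. *)
Lemma Gamma_gt0 (R : realType) (x : R) : 0 < x < 2 -> 0 < Gamma x.
Proof.
move=> x02; have /andP[x0 x2] := x02.
pose D : set R := [set t | 0 < t].
have mD : measurable D by rewrite /D -set_itvoy; exact: measurable_itv.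
pose f (t : R) := t `^ (x - 1) * expR (- t).
have f0 t : 0 <= f t by rewrite mulr_ge0 ?powR_ge0 ?expR_ge0.
have mf : measurable_fun setT f.
  apply: measurable_funM; first exact: measurable_powR.
  apply: continuous_measurable_fun => y.
  apply: (@continuous_comp _ _ _ (fun t : R => - t) expR); last exact: continuous_expR.
  by apply: cvgN; exact: cvg_id.
have mfD : measurable_fun D (EFin \o f).
  by apply/measurable_EFinP; exact: (measurable_funS measurableT _ mf).
pose p := Num.max 0 (1 - x).
have p01 : 0 <= p < 1 by rewrite /p; case: (leP 0 (1 - x)) => h; lra.
have fin : (\int[@lebesgue_measure R]_(t in D) (f t)%:E < +oo)%E.
  pose g t : R := if t < 1 then ushape 1 p t else 0.
  have mg : measurable_fun setT g.
    by apply: measurable_fun_ifT => //; [exact: measurable_fun_ltr|exact: ushape_measurable].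
  have g0 t : 0 <= g t by rewrite /g; case: ifP => // _; exact: ushape_ge0.
  have mpdf : measurable_fun setT (fun t : R => 4 * exponential_pdf 2^-1 t).
    by apply: measurable_funM => //; exact: measurable_exponential_pdf.
  have pdf0 t : 0 <= 4 * exponential_pdf 2^-1 t :> R.
    by rewrite mulr_ge0// exponential_pdf_ge0.
  apply: (@le_lt_trans _ _ (\int[@lebesgue_measure R]_(t in D) ((g t)%:E + (4 * exponential_pdf 2^-1 t)%:E))%E).
    apply: ge0_le_integral => //.
    - by move=> t _; rewrite lee_fin.
    - by apply: emeasurable_funD; apply/measurable_EFinP; exact: (measurable_funS measurableT).
    - by move=> t Dt; rewrite -EFinD lee_fin; exact: Gamma_integrand_le.
  rewrite ge0_integralD//; last 4 first.
  - by move=> t _; rewrite lee_fin.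
  - by apply/measurable_EFinP; exact: (measurable_funS measurableT).
  - by move=> t _; rewrite lee_fin.
  - by apply/measurable_EFinP; exact: (measurable_funS measurableT).
  apply: lte_add_pinfty.
    apply: (@le_lt_trans _ _ (2 * 1 / (1 - p))%:E); last exact: ltry.
    apply: le_trans (integral_ushape ltr01 p01); rewrite le_eqVlt; apply/orP; left; apply/eqP.
    rewrite integral_mkcond [RHS]integral_mkcond; apply: eq_integral => t _.
    rewrite !patchE /g.
    have -> : (t \in `]0, 1[%classic) = (t \in D) && (t < 1).
      apply/idP/idP => [/set_mem|/andP[/set_mem h1 h2]].
        by rewrite /= in_itv/= => /andP[h1 ->]; rewrite andbT; exact: mem_set.
      by apply/mem_set; rewrite /= in_itv/= h2 andbT.
    by case: (t \in D) => //=; case: ifP.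
  apply: (@le_lt_trans _ _ (\int[@lebesgue_measure R]_t (4 * exponential_pdf 2^-1 t)%:E)%E).
    apply: ge0_subset_integral => //; first exact/measurable_EFinP.
    by move=> t _; rewrite lee_fin.
  under eq_integral do rewrite EFinM.
  rewrite ge0_integralZl//; last 2 first.
  - by apply/measurable_EFinP; exact: measurable_exponential_pdf.
  - by move=> t _; rewrite lee_fin exponential_pdf_ge0.
  by rewrite integral_exponential_pdf// mule1 ltry.
pose I : set R := `[1, 2]%classic.
have mI : measurable I by exact: measurable_itv.
have low : ((expR (-2) / 2)%:E <= \int[@lebesgue_measure R]_(t in D) (f t)%:E)%E.
  apply: (@le_trans _ _ (\int[@lebesgue_measure R]_(t in I) (f t)%:E)%E); last first.
    apply: ge0_subset_integral => //.
      by move=> t _; rewrite lee_fin.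
    by move=> t; rewrite /I/= in_itv/= => /andP[h1 _]; rewrite /D/=; lra.
  apply: (@le_trans _ _ (\int[@lebesgue_measure R]_(t in I) (expR (-2) / 2)%:E)%E).
    rewrite integral_cst// -[leLHS]mule1 lee_pmul2l ?fin_numE// ?lte_fin ?divr_gt0 ?expR_gt0//.
    apply: le_trans (_ : (_ <= lebesgue_measure I)%E) _ => //.
    rewrite lebesgue_measure_itv/= lte_fin ltr1n -EFinB lee_fin; lra.
  apply: ge0_le_integral => //.
    by apply/measurable_EFinP; exact: (measurable_funS measurableT _ mf).
  move=> t; rewrite /I/= in_itv/= => /andP[t1 t2]; rewrite lee_fin mulrC.
  apply: ler_pM; rewrite ?expR_ge0 ?invr_ge0//.
    apply: (@le_trans _ _ (t `^ (-1))); last by apply: ler_powR; lra.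
    by rewrite powR_inv1; [rewrite lef_pV2 ?posrE//; lra|lra].
  by rewrite ler_expR lerN2.
rewrite /Gamma /Rintegral fine_gt0//.
rewrite fin andbT; apply: lt_le_trans low.
by rewrite lte_fin divr_gt0 ?expR_gt0.
Qed.

Lemma cH_gt0 (R : realType) (H : R) : 0 < H < 1 -> 0 < cH H.
Proof.
move=> /andP[H0 H1].
have g1 : 0 < Gamma (H + 2^-1) by apply: Gamma_gt0; lra.
have g2 : 0 < Gamma (3 / 2 - H) by apply: Gamma_gt0; lra.
have g3 : 0 < Gamma (2 - 2 * H) by apply: Gamma_gt0; lra.
by rewrite /cH mulr_gt0 ?invr_gt0// sqrtr_gt0 divr_gt0// !mulr_gt0.
Qed.

(** * The law of the integral process *)

Section zH_at_t.
Context (R : realType) (H D t : R) (H01 : 0 < H < 1) (t0 : 0 < t) (D0 : 0 < D)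
  (zD : forall s, 0 < s < 1 ->
    zH H 1 s ^+ 2 <= D * Num.min s (1 - s) `^ (- (2 * `|2^-1 - H|))).

Lemma zH_out (x : R) : ~~ (0 < x < t) -> zH H t x = 0.
Proof. by rewrite /zH => /negbTE ->. Qed.

Let scaled_itv (x : R) : 0 < x < t -> 0 < x / t < 1.
Proof. by move=> /andP[x0 xt]; rewrite divr_gt0//= ltr_pdivrMr// mul1r. Qed.

Lemma zH_continuous_at (x : R) : 0 < x < t -> x != t / 2 -> {for x, continuous (zH H t)}.
Proof.
move=> xt x2.
have -> : zH H t = (fun y => t `^ (H - 2^-1) * zH H 1 (y / t)).
  by apply/funext => y; exact: zH_scale.
apply: continuousM; first exact: cst_continuous.
apply: (@continuous_comp _ _ _ (fun y : R => y / t) (zH H 1)).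
  by apply: continuousM; [exact: cvg_id|exact: cst_continuous].
apply: zH_continuous => //; first exact: scaled_itv.
apply: contra x2 => /eqP e; apply/eqP.
by rewrite -[x](divfK (lt0r_neq0 t0)) e mulrC.
Qed.

Lemma zH_ushape (x : R) : 0 < x < t ->
  zH H t x ^+ 2 <= t `^ (2 * H - 1) * D * ushape t (2 * `|2^-1 - H|) x.
Proof.
move=> xt; rewrite zH_scale// exprMn -mulrA.
have -> : (t `^ (H - 2^-1)) ^+ 2 = t `^ (2 * H - 1).
  by rewrite -powR_mulrn ?powR_ge0// -powRrM; congr (_ `^ _); lra.
rewrite ler_wpM2l ?powR_ge0//; apply: le_trans (zD (scaled_itv xt)) _.
rewrite ler_pM2l// /ushape (_ : Num.min (x / t) (1 - x / t) = Num.min x (t - x) / t)//.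
by rewrite minr_pMl ?invr_ge0 ?(ltW t0)// mulrBl divff// gt_eqF.
Qed.

End zH_at_t.

Section not_self_similar.
Context (R : realType) (d : measure_display) (Omega : measurableType d)
  (P : probability Omega R) (H : R) (L Y : R -> {RV P >-> R})
  (H01 : 0 < H < 1) (levyL : levy_process L)
  (intY : forall t : R, 0 <= t ->
     is_L2_stoch_integral P (fun r w => L r w) (zH H t) (Y t))
  (psi : R -> R) (psiE : forall u, char_sqr P (L 1) u = expR (- (2 * psi u)))
  (D : R) (D0 : 0 < D)
  (zD : forall s, 0 < s < 1 ->
    zH H 1 s ^+ 2 <= D * Num.min s (1 - s) `^ (- (2 * `|2^-1 - H|))).

Let p : R := 2 * `|2^-1 - H|.
Let p01 : 0 <= p < 1.
Proof.
rewrite /p mulr_ge0//=.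
have : `|2^-1 - H| < 2^-1 by rewrite ltr_norml; case/andP: H01; lra.
lra.
Qed.

(** With 2a(k+1) cells on (0, a/b) the mesh is 1/(2b(k+1)), the inverse of an integer, as
    [char_sqr_stepintE] requires. *)
Lemma levy_integral_char_cvg (a b : nat) (t u : R) : (0 < a)%N -> (0 < b)%N ->
  t = a%:R / b%:R ->
  (fun k => let N := (a * k.+1)%N in let h : R := ((2 * b) * k.+1)%:R^-1 in
    expR (- (2 * (h * \sum_(i < 2 * N) psi (u * zH H t (tag h N i)))))) @ \oo -->
  char_sqr P (Y t) u.
Proof.
move=> a0 b0 tE; have t0 : 0 < t by rewrite tE divr_gt0// ltr0n.
pose N k := (a * k.+1)%N; pose h k : R := t / (2 * N k)%:R.
have hE k : h k = ((2 * b) * k.+1)%:R^-1.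
  rewrite /h tE /N !natrM; field.
  by rewrite !pnatr_eq0 -!lt0n a0 b0 nat1r pnatr_eq0.
have cv := @stepfun_tag_L2_cvg R t p (t `^ (2 * H - 1) * D) a (zH H t) t0 p01 a0
  (mulr_ge0 (powR_ge0 _ _) (ltW D0)) (zH_out H (t := t)) (zH_continuous_at H01 t0)
  (zH_ushape t0 D0 zD).
have := intY (ltW t0) (N := fun k => (2 * N k)%N)
   (a := fun k (i : 'I_(2 * N k)) => zH H t (tag (h k) (N k) i))
   (l := fun k => @grid_l R (h k) _) (r := fun k => @grid_r R (h k) _).
have h0 k : 0 < h k by rewrite hE invr_gt0 ltr0n !muln_gt0 b0.
have hlr k (i : 'I_(2 * N k)) : 0 <= @grid_l R (h k) _ i /\ @grid_l R (h k) _ i <= @grid_r R (h k) _ i.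
  split; first by rewrite mulr_ge0// ltW.
  by rewrite ler_pM2r// ler_nat.
move=> /(_ hlr cv) cvS.
have mS k : measurable_fun setT (stepint (fun r w => L r w)
    (fun i : 'I_(2 * N k) => zH H t (tag (h k) (N k) i)) (@grid_l R (h k) _) (@grid_r R (h k) _)).
  apply: measurable_sum => i; apply: measurable_funM => //.
  by apply: measurable_funB; exact: measurable_funPT.
have cvC := @char_sqr_L2_cvg _ _ _ P _ _ u mS (@measurable_funPT _ _ _ _ (Y t)) cvS.
apply: cvg_trans cvC; apply: near_eq_cvg; apply: nearW => k /=.
rewrite hE (char_sqr_stepintE levyL psiE)//.
by rewrite !muln_gt0 b0.
Qed.

(** The power t^(2H) is t^(2H-1) from the scaling of the squared kernel times t from
    [sum_tag_sqr_le]; the constant lam is summed over cells of total length t. *)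
Lemma levy_integral_char_ge (a b : nat) (t kap lam u : R) : (0 < a)%N -> (0 < b)%N ->
  t = a%:R / b%:R -> 0 <= kap -> (forall x, psi x <= kap * x ^+ 2 + lam) ->
  expR (- (2 * (kap * u ^+ 2 * (2 * D / (1 - p)) * t `^ (2 * H) + t * lam))) <=
  char_sqr P (Y t) u.
Proof.
move=> a0 b0 tE kap0 hpsi; have t0 : 0 < t by rewrite tE divr_gt0// ltr0n.
have cv := @levy_integral_char_cvg a b t u a0 b0 tE.
rewrite -(cvg_lim _ cv)//; apply: limr_ge; first by apply/cvg_ex; eexists; exact: cv.
apply: nearW => k /=; rewrite ler_expR lerN2 ler_pM2l//.
set N := (a * k.+1)%N; set h : R := _^-1.
have hE : h = t / (2 * N)%:R.
  rewrite /h tE /N !natrM; field.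
  by rewrite !pnatr_eq0 -!lt0n a0 b0 nat1r pnatr_eq0.
have h0 : 0 < h by rewrite /h invr_gt0 ltr0n !muln_gt0 b0.
have NN0 : (2 * N)%:R != 0 :> R by rewrite pnatr_eq0 -lt0n !muln_gt0 a0.
have hs := @sum_tag_sqr_le R t p (t `^ (2 * H - 1) * D) a (zH H t) t0 p01 a0
  (mulr_ge0 (powR_ge0 _ _) (ltW D0)) (zH_ushape t0 D0 zD) k.
rewrite -/N -hE in hs.
apply: (@le_trans _ _ (h * \sum_(i < 2 * N) (kap * u ^+ 2 * zH H t (tag h N i) ^+ 2 + lam))).
  rewrite ler_pM2l//; apply: ler_sum => i _; apply: le_trans (hpsi _) _.
  by rewrite exprMn mulrA.
rewrite big_split/= -mulr_sumr sumr_const card_ord mulrDr; apply: lerD; last first.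
  by rewrite -[lam *+ _]mulr_natl mulrA hE divfK.
have -> : t `^ (2 * H) = t `^ (2 * H - 1) * t.
  rewrite [RHS]mulrC mulr_powRB1 ?(ltW t0)//.
  by case/andP: H01 => H0 _; rewrite mulr_gt0.
have ku0 : 0 <= kap * u ^+ 2 by exact: mulr_ge0 kap0 (sqr_ge0 u).
rewrite mulrCA -[leRHS]mulrA ler_wpM2l//.
rewrite mulrC; apply: le_trans hs _.
by rewrite le_eqVlt; apply/orP; left; apply/eqP; ring.
Qed.

Lemma levy_integral_char_lt (c0 u0 : R) : 0 < c0 -> 0 < u0 ->
  (forall x, 0 <= psi x) -> (forall x, `|x| <= u0 -> c0 * x ^+ 2 <= psi x) ->
  exists v e : R, 0 < e /\ char_sqr P (Y 1) v <= expR (- (2 * e)).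
Proof.
move=> c00 u00 psi0 hpsi.
have cH0 := cH_gt0 H01; have D0' := D0.
(* On [4/5, 9/10] the squared kernel is at most 10 D <= (1 + 10 D)^2, so v times the kernel stays
   within u0, where the lower bound on psi holds. *)
pose v := u0 / (1 + 10 * D); pose m := cH H / 20.
have d1 : 0 < 1 + 10 * D by lra.
have v0 : 0 < v by rewrite divr_gt0.
have m0 : 0 < m by rewrite divr_gt0.
exists v, (c0 * (v * m) ^+ 2 / 10); split.
  by rewrite divr_gt0// mulr_gt0// exprn_gt0// mulr_gt0.
(* Writing 1 as 5/5 gives 10 K cells, so that 4/5 and 9/10 are the grid points 8 K and 9 K. *)
have e55 : 1 = 5%:R / 5%:R :> R by rewrite divff// pnatr_eq0.
have cv := @levy_integral_char_cvg 5 5 1 v isT isT e55.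
rewrite -(cvg_lim _ cv)//; apply: limr_le; first by apply/cvg_ex; eexists; exact: cv.
apply: nearW => k /=; rewrite ler_expR lerN2 ler_pM2l//.
set K := k.+1; set N := (5 * K)%N; set h : R := (2 * 5 * K)%:R^-1.
have K0 : 0 < K%:R :> R by rewrite ltr0n.
have hE : h = (10 * K%:R)^-1 by rewrite /h natrM.
have h0 : 0 < h by rewrite hE invr_gt0 mulr_gt0.
pose F (i : nat) := psi (v * zH H 1 ((if (i < N)%N then i.+1%:R else i%:R) * h)).
have F0 i : 0 <= F i by exact: psi0.
(* These [K] of the [10 * K] tags lie in [4/5, 9/10]. *)
have good i : (8 * K <= i < 9 * K)%N -> c0 * (v * m) ^+ 2 <= F i.
  move=> /andP[i1 i2]; rewrite /F ifF; last first.
    by apply/negbTE; rewrite -leqNgt; apply: leq_trans i1; rewrite leq_mul2r orbT.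
  set s : R := i%:R * h.
  have s1 : 4 / 5 <= s.
    rewrite /s hE ler_pdivlMr ?mulr_gt0//.
    have : (8 * K)%:R <= i%:R :> R by rewrite ler_nat.
    by rewrite natrM; lra.
  have s2 : s <= 9 / 10.
    rewrite /s hE ler_pdivrMr ?mulr_gt0//.
    have : i%:R <= (9 * K)%:R :> R by rewrite ler_nat ltnW.
    by rewrite natrM; lra.
  have zl : m <= zH H 1 s by apply: zH_lower => //; [rewrite s1 s2|exact: ltW].
  have zu : zH H 1 s ^+ 2 <= 10 * D.
    have s01 : 0 < s < 1 by lra.
    apply: le_trans (zD s01) _; rewrite mulrC ler_pM2r// min_r; last by lra.
    apply: (@le_trans _ _ (10^-1 `^ (- p))).
      by apply: le_powRN; [lra|lra|case/andP: p01].
    rewrite -powR_inv1// -powRrM mulrN mulN1r opprK -[leRHS]powRr1//.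
    by apply: ler_powR; [lra|case/andP: p01 => _ /ltW].
  apply: (@le_trans _ _ (c0 * (v * zH H 1 s) ^+ 2)).
    have vm : v * m <= v * zH H 1 s by rewrite ler_pM2l.
    have vm0 : 0 <= v * m by exact: ltW (mulr_gt0 v0 m0).
    by rewrite ler_pM2l//; apply: lerXn2r; rewrite ?nnegrE//; exact: le_trans vm.
  apply: hpsi; rewrite -(@ler_pXn2r _ 2)// ?nnegrE ?(ltW u00)// real_normK ?num_real//.
  rewrite exprMn; apply: (@le_trans _ _ (v ^+ 2 * (10 * D))).
    by rewrite ler_wpM2l// sqr_ge0.
  rewrite /v expr_div_n mulrAC ler_pdivrMr ?exprn_gt0// ler_wpM2l ?sqr_ge0//.
  nra.
have -> : \sum_(i < 2 * N) psi (v * zH H 1 (tag h N i)) = \sum_(0 <= i < 2 * N) F i.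
  by rewrite big_mkord; apply: eq_bigr.
have -> : c0 * (v * m) ^+ 2 / 10 = h * (c0 * (v * m) ^+ 2 *+ K).
  rewrite -mulr_natl hE; field.
  by rewrite /K -nat1r in K0 *; rewrite gt_eqF.
rewrite ler_pM2l//.
have N10 : (2 * N = 10 * K)%N by rewrite /N mulnA.
rewrite (@big_cat_nat _ _ _ (8 * K))//=; last by rewrite N10 leq_mul2r orbT.
rewrite [X in _ + X](@big_cat_nat _ _ _ (9 * K))//=;
  [|by rewrite leq_mul2r orbT|by rewrite N10 leq_mul2r orbT].
apply: (@le_trans _ _ (\sum_(8 * K <= i < 9 * K) F i)); last first.
  have n1 (x y : nat) : 0 <= \sum_(x <= i < y) F i by apply: sumr_ge0.
  by have := n1 0%N (8 * K)%N; have := n1 (9 * K)%N (2 * N)%N; lra.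
apply: (@le_trans _ _ (\sum_(8 * K <= i < 9 * K) c0 * (v * m) ^+ 2)).
  by rewrite sumr_const_nat (_ : (9 * K - 8 * K)%N = K)// -mulnBl mul1n.
by apply: ler_sum_nat => i; exact: good.
Qed.

Lemma levy_integral_not_self_similar (V c0 u0 : R) :
  0 < c0 -> 0 < u0 -> 0 <= V -> (forall x, 0 <= psi x) ->
  (forall x, `|x| <= u0 -> c0 * x ^+ 2 <= psi x) ->
  (forall x, psi x <= V * x ^+ 2) ->
  (forall eps, 0 < eps -> exists lam, forall x, psi x <= eps * x ^+ 2 + lam) ->
  ~ (exists alpha : R, self_similar Y alpha).
Proof.
move=> c00 u00 V0 psi0 psi_low psi_up psi_eps [al ss].
have [v [e [e0 hv]]] := levy_integral_char_lt c00 u00 psi0 psi_low.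
pose C := 2 * D / (1 - p).
have C0 : 0 <= C.
  by case/andP: p01 => _ p1; rewrite divr_ge0 ?mulr_ge0 ?(ltW D0)// subr_ge0 ltW.
(* Y_t has the law of t^al Y_1, so v t^(-al) is to Y_t what v is to Y_1: the lower bound for Y_t
   meets the upper bound for Y_1. *)
have key (a b : nat) (t kap lam : R) : (0 < a)%N -> (0 < b)%N -> t = a%:R / b%:R ->
    0 <= kap -> (forall x, psi x <= kap * x ^+ 2 + lam) ->
    e <= kap * v ^+ 2 * C * t `^ (2 * H - 2 * al) + t * lam.
  move=> a0 b0 tE kap0 hpsi; have t0 : 0 < t by rewrite tE divr_gt0// ltr0n.
  have h := @levy_integral_char_ge a b t kap lam (v * t `^ (- al)) a0 b0 tE kap0 hpsi.
  have hY : char_sqr P (Y t) (v * t `^ (- al)) = char_sqr P (Y 1) v.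
    transitivity (char_sqr P (fun w => t `^ al * Y 1 w) (v * t `^ (- al))).
      apply: char_sqr_eq_dist => [||B mB].
      - exact: measurable_funPT.
      - by apply: measurable_funM => //; exact: measurable_funPT.
      have := ss t t0 1%N (fun=> 1) (fun=> B) (fun=> ler01) (fun=> mB).
      have e1 (Q : Omega -> Prop) : [set w | forall i : 'I_1, Q w] = [set w | Q w].
        by apply/seteqP; split => w /=; [apply; exact: ord0|].
      by rewrite !e1 mulr1.
    rewrite /char_sqr; congr (_ ^+ 2 + _ ^+ 2); apply: eq_Rintegral => w _; congr (_ _);
      rewrite mulrA -(mulrA v) -powRD ?addNr ?powRr0 ?mulr1//; by rewrite (gt_eqF t0) implybT.
  rewrite hY in h.
  have := le_trans h hv; rewrite ler_expR lerN2 ler_pM2l// => /le_trans; apply.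
  rewrite lerD2r exprMn -/C.
  have -> : t `^ (2 * H - 2 * al) = (t `^ (- al)) ^+ 2 * t `^ (2 * H).
    rewrite -powR_mulrn ?powR_ge0// -powRrM -powRD; last by rewrite (gt_eqF t0) implybT.
    by congr (_ `^ _); ring.
  by rewrite le_eqVlt; apply/orP; left; apply/eqP; ring.
have trunc_gt (y : R) : 0 <= y -> y < (Num.truncn y).+1%:R.
  by move=> y0; have /andP[] := truncn_itv y0.
have v2 := sqr_ge0 v.
have [Hal|Hal] := ltP H al.
(* Scale c = n, with lam = 0: n^r >= 2 W / e makes the right side of [key] smaller than e. *)
- pose r := 2 * (al - H); have r0 : 0 < r by rewrite mulr_gt0// subr_gt0.
  pose W := V * v ^+ 2 * C + 1.
  have W0 : 0 < W by apply: ltr_pwDr => //; apply: mulr_ge0 => //; exact: mulr_ge0.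
  have We0 : 0 < 2 * W / e by rewrite divr_gt0// mulr_gt0.
  pose n := (Num.truncn ((2 * W / e) `^ r^-1)).+1.
  have hn : (2 * W / e) `^ r^-1 < n%:R by apply: trunc_gt; exact: powR_ge0.
  have n0 : 0 < n%:R :> R by rewrite ltr0n.
  have hnr : 2 * W / e <= n%:R `^ r.
    have -> : 2 * W / e = ((2 * W / e) `^ r^-1) `^ r.
      by rewrite -powRrM mulVf ?gt_eqF// powRr1// ltW.
    by apply: ge0_ler_powR; rewrite ?nnegrE ?powR_ge0 ?(ltW r0) ?(ltW hn) ?(ltW n0).
  have := @key n 1%N n%:R V 0 isT isT (esym (divr1 _)) V0; rewrite mulr0 addr0.
  have psi_up' x : psi x <= V * x ^+ 2 + 0 by rewrite addr0.
  move=> /(_ psi_up'); rewrite leNgt => /negP; apply.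
  have -> : n%:R `^ (2 * H - 2 * al) = (n%:R `^ r)^-1 :> R.
    by rewrite -powRN; congr (_ `^ _); rewrite /r; ring.
  rewrite ltr_pdivrMr ?powR_gt0//.
  have : 2 * W <= n%:R `^ r * e by rewrite -ler_pdivrMr.
  rewrite /W in W0 *; lra.
(* Scale c = 1/n: [kap] keeps the first term below e/4, since the power of 1/n is at most 1. Only
   then is n chosen, depending on [lam], to keep lam/n below e/4. *)
- pose kap := e / (4 * (v ^+ 2 * C + 1)).
  have vC0 : 0 <= v ^+ 2 * C by rewrite mulr_ge0.
  have kap0 : 0 < kap by rewrite divr_gt0// mulr_gt0//; lra.
  have [lam hlam] := psi_eps kap kap0.
  pose n := (Num.truncn (4 * `|lam| / e)).+1.
  have hn : 4 * `|lam| / e < n%:R.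
    by apply: trunc_gt; rewrite divr_ge0 ?mulr_ge0// ltW.
  have n0 : 0 < n%:R :> R by rewrite ltr0n.
  have := @key 1%N n n%:R^-1 kap lam isT isT (esym (div1r _)) (ltW kap0) hlam.
  rewrite leNgt => /negP; apply.
  have h1 : n%:R^-1 `^ (2 * H - 2 * al) <= 1.
    rewrite -[leRHS](one_powR (2 * H - 2 * al)); apply: ge0_ler_powR.
    - by lra.
    - by rewrite nnegrE invr_ge0 ltW.
    - by rewrite nnegrE.
    - by rewrite invf_le1// ler1n.
  have h2 : n%:R^-1 * lam <= e / 4.
    rewrite mulrC ler_pdivrMr//; apply: le_trans (ler_norm _) _.
    by rewrite ltr_pdivrMr// in hn; lra.
  have h3 : kap * (v ^+ 2 * C) <= e / 4.
    rewrite /kap mulrAC ler_pdivrMr ?mulr_gt0//; last lra.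
    by set w := v ^+ 2 * C in vC0 *; nra.
  have h4 : kap * v ^+ 2 * C * n%:R^-1 `^ (2 * H - 2 * al) <= e / 4.
    apply: le_trans h3; rewrite -[kap * v ^+ 2 * C]mulrA -[leRHS]mulr1.
    by apply: ler_wpM2l => //; rewrite mulr_ge0// ltW.
  lra.
Qed.

End not_self_similar.

Theorem mainTheorem9 (R : realType) (d : measure_display) (Omega : measurableType d)
  (P : probability Omega R) (H : R) (L Y : R -> {RV P >-> R}) :
  0 < H < 1 ->
  levy_process L ->
  no_gaussian_component L ->
  ~ (forall t : R, 0 <= t -> P [set w | L t w != 0] = 0%E) ->
  (\int[P]_w ((L 1 w) ^+ 2)%:E < +oo)%E ->
  (\int[P]_w (L 1 w)%:E = 0)%E ->
  (forall t : R, 0 <= t -> is_L2_stoch_integral P (fun r w => L r w) (zH H t) (Y t)) ->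
  ~ (exists alpha : R, self_similar Y alpha).
Proof.
move=> H01 levyL [gamma [nu [_ _ nu_fin LK]]] Lnz L2 L0 intY.
have mL1 : measurable_fun setT (L 1) by exact: measurable_funPT.
pose psi := levy_exponent nu.
have psiE u : char_sqr P (L 1) u = expR (- (2 * psi u)).
  (* Drift and compensator enter only through the phase [B], which disappears in cos^2 + sin^2 =
     1. *)
  have [hc hs] := LK u; rewrite /char_sqr /Rintegral hc hs /= !exprMn -mulrDr cos2Dsin2 mulr1.
  rewrite mul0r mul0r oppr0 add0r (levy_exponentE nu_fin) -expRM_natl; congr expR.
  by rewrite -/psi; ring.
have L1 : P [set w | L 1 w != 0] <> 0%E.
  by move=> L1; apply: Lnz; exact: (levy_zero levyL L1).
have [D D0 zD] := zH_bound H01.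
have psi_up := exponent_le_sqr mL1 L2 psiE (levy_exponent_double nu_fin).
have [c0 [u0 [c00 u00 psi_low]]] := exponent_ge_sqr mL1 L2 psiE L0 L1.
apply: (levy_integral_not_self_similar H01 levyL intY psiE D0 zD c00 u00 _ _ psi_low psi_up).
- by apply: Rintegral_ge0 => w _; exact: sqr_ge0.
- exact: levy_exponent_ge0.
- exact: levy_exponent_growth.
Qed.
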